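(* For $a \in \bar{\mathbb{Q}}$ let $C_{242,a} \subset \mathbb{P}^4$, with homogeneous coordinates $(q:s:t:u:z)$, be the curve \[ V\big(az^2 - t^2 - (tz - s^2),\; az^2 - t^2 - (-tz - u^2),\; az^2 - t^2 - (sz - q^2)\big). \] Then the (geometric) genus of $C_{242,a}$ is $3$ if $a = 0$, is $4$ if $a = 2$, and is $3$ if $a$ is one of the three $3^{\mathrm{rd}}$ critical values $a_1, a_2, a_3$ of $f_c$.
   Context: $f_c(x) = x^2 + c$. The three $3^{\mathrm{rd}}$ critical values of $f_c$ are the numbers $a = f_{c_0}^3(0) = (c_0^2+c_0)^2 + c_0$ where $c_0$ is a root of $\frac{d}{dc} f_c^3(0) = 4c^3 + 6c^2 + 2c + 1$. *)

(* Defs.v *)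
From HB Require Import structures.
From mathcomp Require Import all_boot all_order all_algebra all_field.
From mathcomp Require Import ring.
From mathcomp.multinomials Require Import mpoly.

Set Implicit Arguments.
Unset Strict Implicit.
Unset Printing Implicit Defensive.

Import GRing.Theory.
Local Open Scope ring_scope.

Section ProjectiveSets.

Variables (k : closedFieldType) (n : nat).

(* A subset of P^n, given by the nonzero vectors of homogeneous coordinates of
   its points. *)
Definition proj_set := ('I_n.+1 -> k) -> Prop.

(* V(fs), for homogeneous polynomials fs. *)
Definition proj_zeros (fs : seq {mpoly k[n.+1]}) : proj_set :=
  fun x => (exists i, x i != 0) /\ (forall f, f \in fs -> f.@[x] = 0).

Definition vanishes_on (X : proj_set) (p : {mpoly k[n.+1]}) : Prop :=
  forall x, X x -> p.@[x] = 0.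

(* (K, iota) is the function field k(X), with xi the tautological (generic)
   point of X: the homogeneous elements of I(X) are the homogeneous forms killed
   by xi, and F/G |-> F(xi)/G(xi) maps the quotients of forms of equal degree
   with G not in I(X) onto K.  Hence K is the field of such quotients modulo
   F/G ~ F'/G' iff F G' - F' G in I(X).  The existence of such a K forces
   X to be nonempty and I(X) to be prime, i.e. the Zariski closure of X to be
   irreducible. *)
Definition is_function_field (X : proj_set)
    (K : fieldType) (iota : {rmorphism k -> K}) (xi : 'I_n.+1 -> K) : Prop :=
  (forall d (p : {mpoly k[n.+1]}), p \is d.-homog ->
     (mmap iota xi p = 0 <-> vanishes_on X p)) /\
  (forall y : K, exists d (F G : {mpoly k[n.+1]}),
     [/\ F \is d.-homog, G \is d.-homog, mmap iota xi G != 0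
       & y = mmap iota xi F / mmap iota xi G]).

End ProjectiveSets.

Section Extension.

Variables (k K : fieldType) (iota : {rmorphism k -> K}).

Definition alg_independent m (x : 'I_m -> K) : Prop :=
  forall p : {mpoly k[m]}, mmap iota x p = 0 -> p = 0.

Definition has_trdeg (m : nat) : Prop :=
  (exists x : 'I_m -> K, alg_independent x) /\
  ~ (exists x : 'I_m.+1 -> K, alg_independent x).

(* Normalized discrete valuations of K trivial on k; v 0 is irrelevant. *)
Record is_valuation (v : K -> int) : Prop := IsValuation {
  valuationM : forall x y, x != 0 -> y != 0 -> v (x * y) = v x + v y;
  valuationD : forall x y, x != 0 -> y != 0 -> x + y != 0 ->
    Num.min (v x) (v y) <= v (x + y);
  valuationC : forall c, c != 0 -> v (iota c) = 0;
  valuation_uniformizer : exists2 x, x != 0 & v x = 1 }.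

Definition valuation_ring (v : K -> int) (x : K) : Prop := x = 0 \/ 0 <= v x.

Record is_derivation (M : lmodType K) (D : K -> M) : Prop := IsDerivation {
  derivationD : forall x y, D (x + y) = D x + D y;
  derivationM : forall x y, D (x * y) = x *: D y + y *: D x;
  derivationC : forall c, D (iota c) = 0 }.

(* (Omega, d) is the module of Kaehler differentials of K over k. *)
Definition is_kaehler (Omega : lmodType K) (d : K -> Omega) : Prop :=
  is_derivation d /\
  forall (M : lmodType K) (D : K -> M), is_derivation D ->
    exists phi : {linear Omega -> M},
      (forall x, D x = phi (d x)) /\
      (forall psi : {linear Omega -> M},
         (forall x, D x = psi (d x)) -> psi =1 phi).

Section Differentials.

Variables (Omega : lmodType K) (d : K -> Omega).

(* omega is in the O_v-submodule of Omega generated by d(O_v). *)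
Definition regular_at (v : K -> int) (omega : Omega) : Prop :=
  exists s : seq (K * K),
    (forall p, p \in s -> valuation_ring v p.1 /\ valuation_ring v p.2) /\
    omega = \sum_(p <- s) p.1 *: d p.2.

(* If K is a function field of one variable over an algebraically closed k, the
   discrete valuations of K over k are the points of its nonsingular projective
   model. *)
Definition is_regular_form (omega : Omega) : Prop :=
  forall v, is_valuation v -> regular_at v omega.

(* For P stable under k-linear combinations: P has dimension g over k. *)
Definition has_dim (P : Omega -> Prop) (g : nat) : Prop :=
  exists e : 'I_g -> Omega,
    (forall i, P (e i)) /\
    (forall omega, P omega ->
       exists! c : 'rV[k]_g, omega = \sum_i iota (c 0 i) *: e i).

End Differentials.

End Extension.

(* X is an integral projective curve (up to Zariski closure) whose
   normalization Y has dim_k H^0(Y, Omega_Y) = g. *)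
Definition has_geometric_genus (k : closedFieldType) (n : nat)
    (X : proj_set k n) (g : nat) : Prop :=
  exists (K : fieldType) (iota : {rmorphism k -> K}) (xi : 'I_n.+1 -> K)
         (Omega : lmodType K) (d : K -> Omega),
    [/\ is_function_field X iota xi,
        has_trdeg iota 1,
        is_kaehler iota d
      & has_dim iota (is_regular_form iota d) g].

Definition C242 (a : algC) : proj_set algC 4 :=
  let q : {mpoly algC[5]} := 'X_(inord 0) in
  let s : {mpoly algC[5]} := 'X_(inord 1) in
  let t : {mpoly algC[5]} := 'X_(inord 2) in
  let u : {mpoly algC[5]} := 'X_(inord 3) in
  let z : {mpoly algC[5]} := 'X_(inord 4) in
  proj_zeros [:: a *: z ^+ 2 - t ^+ 2 - (t * z - s ^+ 2);
                 a *: z ^+ 2 - t ^+ 2 - (- (t * z) - u ^+ 2);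
                 a *: z ^+ 2 - t ^+ 2 - (s * z - q ^+ 2)].

Definition fquad (R : pzRingType) (c x : R) : R := x ^+ 2 + c.

(* f_c^m(0) as a polynomial in c. *)
Definition crit_orbit (R : nzRingType) (m : nat) : {poly R} :=
  iter m (fquad 'X) 0.

Definition critical_value (R : nzRingType) (m : nat) (a : R) : Prop :=
  exists c0 : R, root (crit_orbit R m)^`() c0 /\ a = iter m (fquad c0) 0.

Lemma critical_value3E (R : comNzRingType) (a : R) :
  critical_value 3 a <->
  exists c0 : R, 4 * c0 ^+ 3 + 6 * c0 ^+ 2 + 2 * c0 + 1 = 0 /\
                 a = (c0 ^+ 2 + c0) ^+ 2 + c0.
Proof.
have E c0 : ((crit_orbit R 3)^`()).[c0] =
    4 * c0 ^+ 3 + 6 * c0 ^+ 2 + 2 * c0 + 1.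
  have -> : crit_orbit R 3 = ('X * 'X + 'X) * ('X * 'X + 'X) + 'X.
    by rewrite /crit_orbit /fquad /=; ring.
  by rewrite !(derivD, derivX, derivM) !(hornerD, hornerM, hornerX, hornerC); ring.
split=> -[c0 [h ->]]; exists c0.
  by split; [rewrite -E; apply/eqP | rewrite /fquad /=; ring].
by split; [rewrite rootE E h | rewrite /fquad /=; ring].
Qed.

(* Main.v *)
Require Import Defs.
From HB Require Import structures.
From mathcomp Require Import all_boot all_order all_algebra all_field.
From mathcomp Require Import polyXY ring zify boolp.
From mathcomp.multinomials Require Import mpoly.

(* On the conic s^2 = t^2 + t z - a z^2, parametrized by w = (s - t) / z, the two other
   equations become u^2 = U(w) and q^2 = Q(w) up to the square of 1 - 2 w, for two
   monic quartics U and Q.  Write U = a1^2 E A and Q = a2^2 E B with A B E squarefree: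
   the function field is K = k(w)(y1, y2) with y1^2 = E A, y2^2 = E B, and
   y3 = y1 y2 / E satisfies y3^2 = A B.  A differential of K is regular iff it is
   h1(w) dw / y1 + h2(w) dw / y2 + h3(w) dw / y3 with polynomials of degree at most
   deg (yi^2) / 2 - 2, so that the genus is the sum of the genera deg (yi^2) / 2 - 1 of
   the three hyperelliptic quotients.  The degrees of (E A, E B, A B) are (2, 4, 6)
   for a = 0, (4, 4, 6) for a = 2 and (4, 2, 6) for a third critical value.

   The places of K are reached through embeddings of K into the Laurent series field
   k((x)), with w = c + x, w = c + x^2 (c a branch point) or w = 1 / x; averaging over
   the signs of y1 and y2 separates the terms of a differential, and specializing the
   generic point at x = 0 yields all points of the curve. *)

Set Implicit Arguments.
Unset Strict Implicit.
Unset Printing Implicit Defensive.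

Import Order.TTheory GRing.Theory Num.Theory.
Local Open Scope ring_scope.

(** * Fraction fields and quadratic extensions *)

(** With z = 1 and c = a - t^2 the equations read f_c(t) = a, f_c(s) = t, f_c(u) = -t, f_c(q) = s:
    the curve parametrizes c together with part of the tree of iterated preimages of a. At the
    special values of a the factorization of U and Q degenerates. For a = 0 the point c = s = t = u
    = 0 gives U the double root 0. For a = 2 the orbit 0, -2, 2, 2 of c = -2 makes u and q vanish
    together, and w = -4 is a common root of U and Q. For a = f_c^3(0) critical, the point q = 0, s
    = c, t = c^2 + c gives Q the double root w = -c^2.

    The genus refers to all discrete valuations of K, and these are never classified. That the
    proposed differentials are regular is shown for an arbitrary valuation, from its axioms; that
    there are no others uses only the valuations induced by Laurent embeddings. The Kaehler module
    is K itself with d = d/dw, an element z standing for z dw. Irreducibility of the curve comes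
    from K being a field, that is, from E A, E B and A B being non-squares in k(w). *)

Definition leibniz (R : pzRingType) (D : R -> R) : Prop :=
  (forall x y, D (x + y) = D x + D y) /\
  (forall x y, D (x * y) = x * D y + y * D x).

Lemma quotient_rule_add (F : fieldType) (a b c d a' b' c' d' : F) :
  b != 0 -> d != 0 ->
  ((a * d' + d * a' + (c * b' + b * c')) * (b * d)
     - (a * d + c * b) * (b * d' + d * b')) / (b * d) ^+ 2 =
  (a' * b - a * b') / b ^+ 2 + (c' * d - c * d') / d ^+ 2.
Proof. by move=> b0 d0; field; apply/andP. Qed.

Lemma quotient_rule_mul (F : fieldType) (a b c d a' b' c' d' : F) :
  b != 0 -> d != 0 ->
  ((a * c' + c * a') * (b * d) - a * c * (b * d' + d * b')) / (b * d) ^+ 2 =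
  a / b * ((c' * d - c * d') / d ^+ 2) + c / d * ((a' * b - a * b') / b ^+ 2).
Proof. by move=> b0 d0; field; apply/andP. Qed.

Section FractionField.

Variable R : idomainType.
Local Notation F := {fraction R}.
Local Notation "x %:F" := (FracField.tofrac x).

Definition num (x : F) : R := \n_(repr x).
Definition den (x : F) : R := \d_(repr x).

Lemma den_neq0 (x : F) : den x != 0.
Proof. exact: denom_ratioP. Qed.

Lemma num_den (x : F) : x = (num x)%:F / (den x)%:F.
Proof.
have E : x * (den x)%:F = (num x)%:F; last first.
  by rewrite -E mulfK // tofrac_eq0 den_neq0.
rewrite /num /den -{1}[x]reprK; move: (repr x) => {}x.
rewrite /GRing.mul /= /FracField.tofrac; unlock.
rewrite -FracField.pi_mul; apply/eqmodP => /=.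
rewrite FracField.equivfE /FracField.mulf !numden_Ratio ?oner_eq0 ?mulf_neq0 ?oner_eq0 //.
- by rewrite !mulr1 mulrC.
- exact: denom_ratioP.
- exact: denom_ratioP.
Qed.

Lemma fracP (x : F) : exists a b : R, b != 0 /\ x = a%:F / b%:F.
Proof. by exists (num x), (den x); rewrite den_neq0 -num_den. Qed.

Lemma eq_frac (a b c d : R) : b != 0 -> d != 0 ->
  (a%:F / b%:F == c%:F / d%:F) = (a * d == c * b).
Proof. by move=> b0 d0; rewrite eqr_div ?tofrac_eq0 // -!tofracM tofrac_eq. Qed.

Section Lift.

Variables (L : fieldType) (phi : {rmorphism R -> L}) (phi_inj : injective phi).

(** The injectivity proof is an argument, so that the morphism instances can be attached to
    [frac_lift phi_inj]; the type [qext nsq] carries its non-square hypothesis for the same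
    reason. *)
Definition frac_lift of injective phi := fun x : F => phi (num x) / phi (den x).
Local Notation lift := (frac_lift phi_inj).

Lemma lift_neq0 b : b != 0 -> phi b != 0.
Proof. by rewrite -(inj_eq phi_inj) rmorph0. Qed.

Lemma frac_lift_div a b : b != 0 -> lift (a%:F / b%:F) = phi a / phi b.
Proof.
move=> b0; set x := _ / _; have := num_den x; rewrite {1}/x => /eqP.
rewrite eq_frac ?den_neq0 // => /eqP E.
by apply/eqP; rewrite eqr_div ?lift_neq0 ?den_neq0 // -!rmorphM E.
Qed.

Lemma frac_lift_tofrac a : lift a%:F = phi a.
Proof.
by rewrite -[a%:F]divr1 -tofrac1 frac_lift_div ?oner_eq0 // rmorph1 divr1.
Qed.

Fact frac_lift_zmod : zmod_morphism lift.
Proof.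
move=> x y; have [a [b [b0 ->]]] := fracP x; have [c [d [d0 ->]]] := fracP y.
rewrite -mulNr addf_div ?tofrac_eq0 // -tofracN -!tofracM -tofracD.
rewrite !frac_lift_div ?mulf_neq0 // rmorphD !rmorphM rmorphN /=.
by have := lift_neq0 b0; have := lift_neq0 d0 => ? ?; field; apply/andP.
Qed.

Fact frac_lift_monoid : monoid_morphism lift.
Proof.
split=> [|x y]; first by rewrite -tofrac1 frac_lift_tofrac rmorph1.
have [a [b [b0 ->]]] := fracP x; have [c [d [d0 ->]]] := fracP y.
by rewrite mulf_div -!tofracM !frac_lift_div ?mulf_neq0 // !rmorphM mulf_div.
Qed.

HB.instance Definition _ := GRing.isZmodMorphism.Build F L lift frac_lift_zmod.
HB.instance Definition _ := GRing.isMonoidMorphism.Build F L lift frac_lift_monoid.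

End Lift.

Section Derivation.

Variables (D : R -> R) (D_leibniz : leibniz D).

Definition frac_der (x : F) : F :=
  (D (num x) * den x - num x * D (den x))%:F / (den x ^+ 2)%:F.

(** The quotient rule does not depend on the fraction: if n / d = a / b, differentiating a d = n b
    expresses [b * D n] through the other derivatives, and the cross-multiplied identity follows. *)
Lemma frac_der_div a b : b != 0 ->
  frac_der (a%:F / b%:F) = (D a * b - a * D b)%:F / (b ^+ 2)%:F.
Proof.
case: D_leibniz => _ DM b0; set x := _ / _; have := num_den x; rewrite {1}/x => /eqP.
rewrite eq_frac ?den_neq0 // => /eqP E; apply/eqP.
rewrite /frac_der eq_frac ?expf_neq0 ?den_neq0 //.
have := congr1 D E; rewrite !DM => E'; apply/eqP.
move: (num x) (den x) E E' (den_neq0 x) => n d E E' d0.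
transitivity (b * (d * (b * D n) - b * n * D d)); first by ring.
have -> : b * D n = a * D d + d * D a - n * D b by rewrite E'; ring.
have -> : b * n = a * d by rewrite E mulrC.
transitivity (b * d ^+ 2 * D a - (n * b) * d * D b); first by ring.
by rewrite -E; ring.
Qed.

Lemma frac_der_tofrac a : frac_der a%:F = (D a)%:F.
Proof.
case: D_leibniz => _ DM.
have D1 : D 1 = 0.
  have /eqP := DM 1 1; rewrite !mul1r.
  by rewrite -[X in X == _]addr0 => /eqP/addrI.
rewrite -[a%:F]divr1 -tofrac1 frac_der_div ?oner_eq0 //.
by rewrite D1 mulr0 subr0 expr1n mulr1 tofrac1 divr1.
Qed.

Lemma frac_der_leibniz : leibniz frac_der.
Proof.
case: (D_leibniz) => DD DM.
split=> x y; have [a [b [b0 ->]]] := fracP x; have [c [d [d0 ->]]] := fracP y.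
  rewrite addf_div ?tofrac_eq0 // -!tofracM -tofracD !frac_der_div ?mulf_neq0 //.
  rewrite DD !DM !(tofracM, tofracD, tofracN, tofracXn).
  by apply: quotient_rule_add; rewrite tofrac_eq0.
rewrite mulf_div -!tofracM !frac_der_div ?mulf_neq0 //.
rewrite !DM !(tofracM, tofracD, tofracN, tofracXn).
by apply: quotient_rule_mul; rewrite tofrac_eq0.
Qed.

End Derivation.

End FractionField.

(** * Adjoining a square root to a field *)

Section QuadraticExtension.

Variables (F : fieldType) (D : F).

(** The pair [(a, b)] stands for a + b sqrt D. *)
Definition qext of (forall x : F, x ^+ 2 != D) : Type := (F * F)%type.

Variable nsq : forall x : F, x ^+ 2 != D.
Local Notation E := (qext nsq).

HB.instance Definition _ := GRing.Zmodule.copy E (F * F)%type.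

Definition qmul (x y : E) : E :=
  (x.1 * y.1 + x.2 * y.2 * D, x.1 * y.2 + x.2 * y.1).
Definition qone : E := (1, 0).
Definition qinv (x : E) : E :=
  (x.1 / (x.1 ^+ 2 - x.2 ^+ 2 * D), - x.2 / (x.1 ^+ 2 - x.2 ^+ 2 * D)).

Fact qmulA : associative qmul.
Proof. by move=> [a b] [c d] [e f]; rewrite /qmul /=; congr pair; ring. Qed.
Fact qmulC : commutative qmul.
Proof. by move=> [a b] [c d]; rewrite /qmul /=; congr pair; ring. Qed.
Fact qmul1 : left_id qone qmul.
Proof. by move=> [a b]; rewrite /qmul /=; congr pair; ring. Qed.
Fact qmulDl : left_distributive qmul +%R.
Proof. by move=> [a b] [c d] [e f]; rewrite /qmul /=; congr pair => /=; ring. Qed.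
Fact qone_neq0 : qone != 0.
Proof. by apply/eqP => -[/eqP]; rewrite oner_eq0. Qed.

HB.instance Definition _ :=
  GRing.Zmodule_isComNzRing.Build E qmulA qmulC qmul1 qmulDl qone_neq0.

Lemma qmulE (x y : E) : x * y = qmul x y. Proof. by []. Qed.

(** A zero norm with b nonzero would give D = (a / b)^2. *)
Lemma qnorm_neq0 (x : E) : x != 0 -> x.1 ^+ 2 - x.2 ^+ 2 * D != 0.
Proof.
case: x => a b /=; rewrite subr_eq0; have [->|b0] := eqVneq b 0.
  rewrite expr0n mul0r expf_eq0 /= => x0; apply: contra x0 => /eqP ->.
  by apply/eqP.
move=> _; have := nsq (a / b); apply: contra => /eqP e.
by rewrite expr_div_n e mulrC mulKf // expf_neq0.
Qed.

Fact qmulV (x : E) : x != 0 -> qmul (qinv x) x = qone.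
Proof.
move=> /qnorm_neq0; case: x => a b /= n0.
by rewrite /qmul /qinv /qone /=; congr pair; field.
Qed.
Fact qinv0 : qinv 0 = 0.
Proof. by rewrite /qinv /= oppr0 !mul0r. Qed.

HB.instance Definition _ := GRing.ComNzRing_isField.Build E qmulV qinv0.

Definition qC (a : F) : E := (a, 0).
Definition qroot : E := (0, 1).

Fact qC_zmod : zmod_morphism qC.
Proof. by move=> a b; rewrite /qC; congr pair; rewrite /= subr0. Qed.
Fact qC_monoid : monoid_morphism qC.
Proof.
split=> // a b; rewrite /qC [RHS]/(qmul _ _) /qmul /=.
by congr pair; rewrite /=; ring.
Qed.
HB.instance Definition _ := GRing.isZmodMorphism.Build F E qC qC_zmod.
HB.instance Definition _ := GRing.isMonoidMorphism.Build F E qC qC_monoid.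

Lemma qrootE : qroot ^+ 2 = qC D.
Proof. by rewrite expr2 [LHS]/(qmul _ _) /qmul /qC /=; congr pair; ring. Qed.

Lemma qextE (x : E) : x = qC x.1 + qC x.2 * qroot.
Proof.
case: x => a b; rewrite [qC _ * _]/(qmul _ _) /qmul /qC /=.
by congr pair; rewrite /=; ring.
Qed.

(** A square root a + b sqrt D of D' has a b = 0, as 2 is invertible; b = 0 makes D' a square, and a
    = 0 makes D D' = (b D)^2 one. This allows the second step of the tower, so D, D' and D D' must
    all be non-squares. *)
Lemma qC_nonsquare (D' : F) : (2 : F) != 0 -> (forall x : F, x ^+ 2 != D') ->
  (forall x : F, x ^+ 2 != D * D') -> forall x : E, x ^+ 2 != qC D'.
Proof.
move=> two nsqD' nsqDD' [a b]; rewrite expr2 qmulE /qmul /qC /=; apply/eqP => -[e1 /eqP].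
have -> : a * b + b * a = 2 * (a * b) by ring.
rewrite !mulf_eq0 (negPf two) /= => /orP[] /eqP ab; move: e1; rewrite ab.
  by rewrite mul0r add0r => e; have := nsqDD' (b * D); rewrite -e; case/eqP; ring.
by rewrite !mul0r addr0 -expr2 => e; have := nsqD' a; rewrite e eqxx.
Qed.

Section Lift.

Variables (L : fieldType) (phi : {rmorphism F -> L}) (r : L).
Hypothesis rE : r ^+ 2 = phi D.

Definition qlift of r ^+ 2 = phi D := fun x : E => phi x.1 + phi x.2 * r.
Local Notation lift := (qlift rE).

Fact qlift_zmod : zmod_morphism lift.
Proof. by move=> [a b] [c d]; rewrite /qlift /= !rmorphB; ring. Qed.
Fact qlift_monoid : monoid_morphism lift.
Proof.
split=> [|[a b] [c d]]; first by rewrite /qlift /= rmorph1 rmorph0; ring.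
by rewrite /qlift /= !(rmorphD, rmorphM) -rE; ring.
Qed.
HB.instance Definition _ := GRing.isZmodMorphism.Build E L lift qlift_zmod.
HB.instance Definition _ := GRing.isMonoidMorphism.Build E L lift qlift_monoid.

Lemma qlift_C a : lift (qC a) = phi a.
Proof. by rewrite /qlift /= rmorph0 mul0r addr0. Qed.
Lemma qlift_root : lift qroot = r.
Proof. by rewrite /qlift /= rmorph0 rmorph1 mul1r add0r. Qed.

End Lift.

Section Derivation.

Variables (d : F -> F) (d_leibniz : leibniz d).
Hypothesis two_neq0 : (2 : F) != 0.

(** The correction term is forced by sqrt(D)' = D' / (2 D) sqrt(D). *)
Definition qder (x : E) : E := (d x.1, d x.2 + x.2 * d D / (2 * D)).

Lemma qder_C a : qder (qC a) = qC (d a).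
Proof.
case: d_leibniz => dD _; rewrite /qder /qC /=; congr pair.
have /eqP := dD 0 0; rewrite addr0 -[X in X == _]addr0 => /eqP/addrI <-.
by rewrite !mul0r addr0.
Qed.

Lemma qder_leibniz : leibniz qder.
Proof.
case: (d_leibniz) => dD dM.
have D0 : D != 0 by have := nsq 0; rewrite expr0n eq_sym.
split=> -[a b] [c e].
  by rewrite /qder /= !dD; congr pair => /=; ring.
rewrite !qmulE /qder /qmul /= !(dD, dM); congr pair => /=; field; exact/andP.
Qed.

End Derivation.

End QuadraticExtension.

Lemma qext_towerE (F : fieldType) (D : F) (nsq : forall x : F, x ^+ 2 != D)
    (D' : qext nsq) (nsq' : forall x : qext nsq, x ^+ 2 != D') (z : qext nsq') :
  let j x := qC nsq' (qC nsq x) in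
  z = j z.1.1 + j z.1.2 * qC nsq' (qroot nsq) + j z.2.1 * qroot nsq'
      + j z.2.2 * (qC nsq' (qroot nsq) * qroot nsq').
Proof.
rewrite /= {1}[z]qextE {1}[z.1]qextE {1}[z.2]qextE !rmorphD !rmorphM /=.
by rewrite mulrDl addrA mulrA.
Qed.

(** * Power series *)

Section PowerSeries.

Variable k : fieldType.

Definition pseries : Type := nat -> k.

HB.instance Definition _ := Choice.copy pseries (nat -> k).

Implicit Types f g h : pseries.

Definition psadd f g : pseries := fun n => f n + g n.
Definition psopp f : pseries := fun n => - f n.
Definition psmul f g : pseries := fun n => \sum_(i < n.+1) f i * g (n - i)%N.
Definition poly_ps (p : {poly k}) : pseries := fun n => p`_n.

Fact psaddA : associative psadd.
Proof. by move=> f g h; apply/funext => n; exact: addrA. Qed.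
Fact psaddC : commutative psadd.
Proof. by move=> f g; apply/funext => n; exact: addrC. Qed.
Fact psadd0 : left_id (poly_ps 0) psadd.
Proof. by move=> f; apply/funext => n; rewrite /psadd /poly_ps coef0 add0r. Qed.
Fact psaddN : left_inverse (poly_ps 0) psopp psadd.
Proof. by move=> f; apply/funext => n; rewrite /psadd /psopp /poly_ps coef0 addNr. Qed.

HB.instance Definition _ :=
  GRing.isZmodule.Build pseries psaddA psaddC psadd0 psaddN.

(** A coefficient of a product or of a derivative only involves finitely many coefficients, so ring
    axioms and the Leibniz rule are transferred from polynomials by truncation. *)
Definition agree n f (p : {poly k}) := forall i, (i <= n)%N -> f i = p`_i.

Definition trunc n f : {poly k} := \poly_(i < n.+1) f i.

Lemma agree_trunc n f : agree n f (trunc n f).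
Proof. by move=> i le_in; rewrite coef_poly ltnS le_in. Qed.

Arguments agree_trunc : clear implicits.

Lemma agree_last n f p : agree n f p -> f n = p`_n.
Proof. exact. Qed.

Lemma agree_mul n f g p q : agree n f p -> agree n g q -> agree n (psmul f g) (p * q).
Proof.
move=> fp gq i le_in; rewrite coefM; apply: eq_bigr => j _.
by rewrite fp ?gq //; have := ltn_ord j; lia.
Qed.

Fact psmulA : associative psmul.
Proof.
move=> f g h; apply/funext => n.
have [[F G] H] := (agree_trunc n f, agree_trunc n g, agree_trunc n h).
rewrite (agree_last (agree_mul F (agree_mul G H))).
by rewrite (agree_last (agree_mul (agree_mul F G) H)) mulrA.
Qed.
Fact psmulC : commutative psmul.
Proof.
move=> f g; apply/funext => n.
have [F G] := (agree_trunc n f, agree_trunc n g).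
by rewrite (agree_last (agree_mul F G)) (agree_last (agree_mul G F)) mulrC.
Qed.
Fact psmul1 : left_id (poly_ps 1) psmul.
Proof.
move=> f; apply/funext => n; have F := agree_trunc n f.
have O : agree n (poly_ps 1) 1 by [].
by rewrite (agree_last (agree_mul O F)) mul1r -F.
Qed.
Fact psmulDl : left_distributive psmul +%R.
Proof.
move=> f g h; apply/funext => n; rewrite -[RHS]big_split /=.
by apply: eq_bigr => i _; rewrite -mulrDl.
Qed.
Fact ps1_neq0 : poly_ps 1 != 0.
Proof.
apply/eqP => /(congr1 (fun f : pseries => f 0%N)).
by rewrite [LHS]coef1 [RHS]coef0 => /eqP; rewrite oner_eq0.
Qed.

HB.instance Definition _ :=
  GRing.Zmodule_isComNzRing.Build pseries psmulA psmulC psmul1 psmulDl ps1_neq0.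

Lemma psmulE f g n : (f * g) n = \sum_(i < n.+1) f i * g (n - i)%N.
Proof. by []. Qed.

Fact poly_ps_zmod : zmod_morphism poly_ps.
Proof. by move=> p q; apply/funext => n; rewrite /poly_ps coefB. Qed.
Fact poly_ps_monoid : monoid_morphism poly_ps.
Proof.
split=> // p q; apply/funext => n.
by rewrite /poly_ps coefM; apply: eq_bigr.
Qed.
HB.instance Definition _ :=
  GRing.isZmodMorphism.Build {poly k} pseries poly_ps poly_ps_zmod.
HB.instance Definition _ :=
  GRing.isMonoidMorphism.Build {poly k} pseries poly_ps poly_ps_monoid.

Definition ct f : k := f 0%N.

Fact ct_zmod : zmod_morphism ct. Proof. by []. Qed.
Fact ct_monoid : monoid_morphism ct.
Proof.
split=> [|f g]; first by rewrite /ct [LHS]coef1.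
by rewrite /ct psmulE big_ord1.
Qed.
HB.instance Definition _ := GRing.isZmodMorphism.Build pseries k ct ct_zmod.
HB.instance Definition _ := GRing.isMonoidMorphism.Build pseries k ct ct_monoid.

Definition psC (c : k) : pseries := poly_ps c%:P.

Fact psC_zmod : zmod_morphism psC.
Proof. by move=> a b; rewrite /psC !rmorphB. Qed.
Fact psC_monoid : monoid_morphism psC.
Proof. by split=> [|a b]; rewrite /psC ?rmorph1 // !rmorphM. Qed.
HB.instance Definition _ := GRing.isZmodMorphism.Build k pseries psC psC_zmod.
HB.instance Definition _ := GRing.isMonoidMorphism.Build k pseries psC psC_monoid.

Definition psX : pseries := poly_ps 'X.

Lemma ct_C c : ct (psC c) = c.
Proof. by rewrite /ct /psC /poly_ps coefC. Qed.
Lemma ct_X : ct psX = 0.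
Proof. by rewrite /ct /psX /poly_ps coefX. Qed.

Definition psshift f : pseries := fun n => f n.+1.

Lemma ct0_shift f : ct f = 0 -> f = psX * psshift f.
Proof.
move=> f0; apply/funext => n; rewrite psmulE.
case: n => [|n]; first by rewrite big_ord1 [psX _]coefX mul0r.
rewrite big_ord_recl [psX _]coefX mul0r add0r big_ord_recl [psX _]coefX mul1r.
rewrite big1 ?addr0 // => [|i _]; first by rewrite /psshift subn1.
by rewrite [psX _]coefX mul0r.
Qed.

Lemma ps_decomp f : f != 0 -> exists n g, ct g != 0 /\ f = psX ^+ n * g.
Proof.
move=> f0; have exn : exists n, f n != 0.
  apply: contrapT => nf; case/eqP: f0; apply/funext => n.
  rewrite [RHS]coef0; apply/eqP; apply: contraT => fn.
  by case: nf; exists n.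
case: (ex_minnP exn) => n; elim: n f {f0 exn} => [|n IH] f fn minf.
  by exists 0%N, f; rewrite expr0 mul1r.
have f0 : ct f = 0 by apply/eqP; apply: contraT => /minf.
have [|m /minf|m [g [g0 e]]] := IH (psshift f); rewrite ?ltnS //.
by exists m.+1, g; rewrite exprS -mulrA -e -ct0_shift.
Qed.

Section Recursion.

Variable G : seq k -> k.

(** Course-of-values recursion: [G] computes a coefficient from the list of all earlier ones, whose
    size is the index. Inverses and square roots are both built this way. *)
Fixpoint ps_prefix n : seq k :=
  if n is m.+1 then rcons (ps_prefix m) (G (ps_prefix m)) else [::].
Definition ps_rec : pseries := fun n => G (ps_prefix n).

Lemma size_prefix n : size (ps_prefix n) = n.
Proof. by elim: n => //= n IH; rewrite size_rcons IH. Qed.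

Lemma nth_prefix n i : (i < n)%N -> (ps_prefix n)`_i = ps_rec i.
Proof.
elim: n => //= n IH; rewrite ltnS leq_eqVlt => /orP[/eqP ->|lt_in].
  by rewrite nth_rcons size_prefix ltnn eqxx.
by rewrite nth_rcons size_prefix lt_in IH.
Qed.

End Recursion.

Definition ps_unit : pred pseries := fun f => ct f != 0.

Definition inv_step f (s : seq k) : k :=
  ((size s == 0)%:R - \sum_(i < size s) s`_i * f (size s - i)%N) / ct f.
Definition psinv f : pseries :=
  if ps_unit f then ps_rec (inv_step f) else f.

Fact psmulV : {in ps_unit, left_inverse 1 psinv *%R}.
Proof.
move=> f uf; rewrite /psinv ifT //; have f0 : ct f != 0 by [].
apply/funext => n; rewrite psmulE big_ord_recr /= subnn -/(ct f).
rewrite {2}/ps_rec /inv_step size_prefix -mulrA mulVf // mulr1.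
under [X in _ - X]eq_bigr do rewrite nth_prefix //.
by rewrite addrC subrK [RHS]coef1.
Qed.
Fact ps_unitP f g : g * f = 1 -> ps_unit f.
Proof.
move=> /(congr1 ct); rewrite rmorphM rmorph1 => /eqP.
by apply: contraTneq => /= ->; rewrite mulr0 eq_sym oner_eq0.
Qed.
Fact psinv_out : {in predC ps_unit, psinv =1 id}.
Proof. by move=> f /negPf nf; rewrite /psinv ifF. Qed.

HB.instance Definition _ :=
  GRing.ComNzRing_hasMulInverse.Build pseries psmulV ps_unitP psinv_out.

Lemma ct_shiftX n f : (psX ^+ n * f) n = ct f.
Proof.
elim: n => [|n IH]; first by rewrite expr0 mul1r.
rewrite exprS -mulrA psmulE big_ord_recl [psX _]coefX mul0r add0r.
rewrite big_ord_recl [psX _]coefX mul1r big1 ?addr0; first by rewrite subn1.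
by move=> i _; rewrite [psX _]coefX mul0r.
Qed.

Fact ps_idomain : GRing.integral_domain_axiom pseries.
Proof.
move=> f g fg0; apply/norP => -[/ps_decomp[n [u [u0 fE]]] /ps_decomp[m [v [v0 gE]]]].
have := congr1 (fun h => h (n + m)%N) fg0.
rewrite fE gE mulrACA -exprD ct_shiftX rmorphM [RHS]coef0 => /eqP.
by rewrite mulf_eq0 (negPf u0) (negPf v0).
Qed.

HB.instance Definition _ := GRing.ComUnitRing_isIntegral.Build pseries ps_idomain.

Lemma ps_unitE f : (f \is a GRing.unit) = (ct f != 0).
Proof. by []. Qed.

Definition sqrt_step f (r : k) (s : seq k) : k :=
  if size s is n.+1
  then (f n.+1 - \sum_(i < n) s`_i.+1 * s`_(n - i)%N) / (2 * r) else r.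

(** In coefficient n + 1 of g^2 the unknown g_(n+1) occurs only in the two extreme terms, as 2 r
    g_(n+1); solving for it needs 2 and r invertible. *)
Lemma ps_sqrt f r : r != 0 -> (2 : k) != 0 -> ct f = r ^+ 2 ->
  exists2 g, g ^+ 2 = f & ct g = r.
Proof.
move=> r0 n2 f0; set g := ps_rec (sqrt_step f r).
have g0 : g 0%N = r by [].
exists g => //; apply/funext => -[|n]; first by rewrite expr2 psmulE big_ord1 g0 -expr2.
rewrite expr2 psmulE big_ord_recl big_ord_recr /= subn0 g0.
have -> : bump 0 n = n.+1 by []. rewrite subnn g0.
have : g n.+1 = (f n.+1 - \sum_(i < n) g i.+1 * g (n - i)%N) / (2 * r).
  rewrite {1}/g /ps_rec /sqrt_step size_prefix; congr (_ / _); congr (_ - _).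
  apply: eq_bigr => i _.
  by rewrite !nth_prefix // ltnS ?leq_subr // ltnW // ltn_ord.
have -> : \sum_(i < n) g (bump 0 i) * g (n.+1 - bump 0 i)%N =
          \sum_(i < n) g i.+1 * g (n - i)%N by apply: eq_bigr => i _.
by move=> ->; field; rewrite r0.
Qed.

Definition psder f : pseries := fun n => f n.+1 *+ n.+1.

Lemma agree_der n f p : agree n.+1 f p -> agree n (psder f) p^`().
Proof. by move=> fp i le_in; rewrite coef_deriv /psder fp. Qed.

Lemma psder_leibniz : leibniz psder.
Proof.
split=> f g; first by apply/funext => n; rewrite /psder [LHS]mulrnDl.
apply/funext => n; have F := agree_trunc n.+1 f; have G := agree_trunc n.+1 g.
have sub q r : agree n.+1 q r -> agree n q r by move=> h i le_in; apply: h; exact: leqW.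
rewrite (agree_last (agree_der (agree_mul F G))) derivM coefD.
have -> : (f * psder g + g * psder f) n =
  psmul f (psder g) n + psmul g (psder f) n by [].
have /agree_last -> := agree_mul (sub _ _ F) (agree_der G).
have /agree_last -> := agree_mul (sub _ _ G) (agree_der F).
by rewrite addrC; congr (_ + _); rewrite mulrC.
Qed.

Lemma psder_poly p : psder (poly_ps p) = poly_ps p^`().
Proof. by apply/funext => n; rewrite /poly_ps coef_deriv. Qed.

End PowerSeries.

(** * Laurent series *)

Section Laurent.

Variable k : fieldType.
Local Notation ps := (pseries k).
Local Notation "x %:F" := (FracField.tofrac x).

Definition laurent : fieldType := {fraction ps}.
Local Notation L := laurent.

Definition lX : L := (psX k)%:F.

Lemma lX_neq0 : lX != 0.
Proof.
rewrite tofrac_eq0; apply/eqP => /(congr1 (fun f : ps => f 1%N)).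
by rewrite [LHS]coefX [RHS]coef0 => /eqP; rewrite oner_eq0.
Qed.

(** Membership in x^n k[[x]]: unlike an order, it makes sense at 0 and is stable under sums. *)
Definition order_ge (n : int) (z : L) : Prop := exists f : ps, z = lX ^ n * f%:F.

Lemma order_geM n m y z : order_ge n y -> order_ge m z -> order_ge (n + m) (y * z).
Proof.
move=> [f ->] [g ->]; exists (f * g).
by rewrite tofracM expfzDr ?lX_neq0 // mulrACA.
Qed.

Lemma order_geW n m z : m <= n -> order_ge n z -> order_ge m z.
Proof.
move=> le_mn [f ->]; have [d ->] : exists d : nat, n = m + d.
  by exists `|n - m|%N; lia.
exists (psX k ^+ d * f); rewrite tofracM tofracXn -/lX exprnP mulrA.
by rewrite expfzDr ?lX_neq0.
Qed.

Lemma order_geD n y z : order_ge n y -> order_ge n z -> order_ge n (y + z).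
Proof. by move=> [f ->] [g ->]; exists (f + g); rewrite tofracD mulrDr. Qed.

Lemma order_geN n z : order_ge n z -> order_ge n (- z).
Proof. by move=> [f ->]; exists (- f); rewrite tofracN mulrN. Qed.

Lemma order_geB n y z : order_ge n y -> order_ge n z -> order_ge n (y - z).
Proof. by move=> ny /order_geN; exact: order_geD. Qed.

Lemma order_ge0 n : order_ge n 0.
Proof. by exists 0; rewrite tofrac0 mulr0. Qed.

Lemma order_ge_tofrac (f : ps) : order_ge 0 f%:F.
Proof. by exists f; rewrite expr0z mul1r. Qed.

Lemma order_ge0P z : order_ge 0 z -> exists f : ps, z = f%:F.
Proof. by move=> [f ->]; exists f; rewrite expr0z mul1r. Qed.

Lemma order_ge_sum n (I : eqType) (s : seq I) (F : I -> L) :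
  (forall i, i \in s -> order_ge n (F i)) -> order_ge n (\sum_(i <- s) F i).
Proof.
elim: s => [|i s IH] Fs; first by rewrite big_nil; exact: order_ge0.
rewrite big_cons; apply: order_geD; first by apply: Fs; rewrite mem_head.
by apply: IH => j js; apply: Fs; rewrite inE js orbT.
Qed.

Definition has_order (n : int) (z : L) : Prop :=
  exists u : ps, ct u != 0 /\ z = lX ^ n * u%:F.

Lemma has_order_neq0 n z : has_order n z -> z != 0.
Proof.
move=> [u [u0 ->]]; apply: mulf_neq0; first by rewrite expfz_neq0 ?lX_neq0.
by rewrite tofrac_eq0; apply: contraNneq u0 => ->; rewrite rmorph0.
Qed.

Lemma has_order_ge n z : has_order n z -> order_ge n z.
Proof. by move=> [u [_ ->]]; exists u. Qed.

Lemma has_orderM n m y z : has_order n y -> has_order m z -> has_order (n + m) (y * z).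
Proof.
move=> [f [f0 ->]] [g [g0 ->]]; exists (f * g).
by rewrite rmorphM mulf_neq0 // tofracM expfzDr ?lX_neq0 // mulrACA.
Qed.

Lemma has_orderV n z : has_order n z -> has_order (- n) z^-1.
Proof.
move=> [f [f0 ->]]; have uf : f \is a GRing.unit by rewrite ps_unitE.
exists f^-1; split; first by rewrite -ps_unitE unitrV.
rewrite invfM invr_expz; congr (_ * _); apply/eqP.
have fF : f%:F != 0 by rewrite tofrac_eq0; apply: contraNneq f0 => ->; rewrite rmorph0.
by rewrite -(inj_eq (mulfI fF)) mulfV // -tofracM divrr // tofrac1.
Qed.

Lemma has_orderX n z m : has_order n z -> has_order (n *+ m) (z ^+ m).
Proof.
move=> h; elim: m => [|m IH].
  by exists 1; rewrite rmorph1 oner_eq0 !expr0 mulr0n expr0z tofrac1 mulr1.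
by rewrite exprS mulrS; exact: has_orderM.
Qed.

Lemma has_order_unit (f : ps) : ct f != 0 -> has_order 0 f%:F.
Proof. by exists f; rewrite expr0z mul1r. Qed.

Lemma has_order_X : has_order 1 lX.
Proof. by exists 1; rewrite rmorph1 oner_eq0 expr1z tofrac1 mulr1. Qed.

Lemma has_orderN n z : has_order n z -> has_order n (- z).
Proof. by move=> [u [u0 ->]]; exists (- u); rewrite rmorphN oppr_eq0 u0 tofracN mulrN. Qed.

Lemma ex_order z : z != 0 -> exists n, has_order n z.
Proof.
have main (f : ps) : f != 0 -> exists n, has_order n f%:F.
  move=> /ps_decomp[n [g [g0 ->]]]; exists n%:Z, g; split => //.
  by rewrite tofracM tofracXn exprnP.
have [a [b [b0 ->]]] := fracP z; have [->|a0] := eqVneq a 0.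
  by rewrite tofrac0 mul0r eqxx.
move=> _; have [n na] := main a a0; have [m mb] := main b b0.
by exists (n - m); apply: has_orderM => //; exact: has_orderV.
Qed.

Lemma order_ge_le n m z : has_order n z -> order_ge m z -> m <= n.
Proof.
move=> [u [u0 ->]] [f e]; rewrite leNgt; apply/negP => lt_nm.
have [d dE] : exists d : nat, m = n + d.+1 by exists `|m - n|.-1%N; lia.
case/eqP: u0; move: e; rewrite dE expfzDr ?lX_neq0 // -mulrA => /mulfI e.
have /e /eqP : lX ^ n != 0 by rewrite expfz_neq0 ?lX_neq0.
rewrite -exprnP -tofracXn -tofracM tofrac_eq => /eqP ->.
by rewrite exprS !rmorphM /= ct_X !mul0r.
Qed.

Lemma has_order_uniq n m z : has_order n z -> has_order m z -> n = m.
Proof.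
move=> hn hm; apply/eqP; rewrite eq_le.
by rewrite (order_ge_le hm (has_order_ge hn)) (order_ge_le hn (has_order_ge hm)).
Qed.

(** The order is chosen classically, with default 0 at z = 0, a value that [is_valuation]
    ignores. *)
Definition ord (z : L) : int :=
  if pselect (exists n, has_order n z) is left h then sval (cid h) else 0.

Lemma ordP z : z != 0 -> has_order (ord z) z.
Proof. by move=> /ex_order h; rewrite /ord; case: pselect => // e; case: cid. Qed.

Lemma ordE n z : has_order n z -> ord z = n.
Proof. by move=> h; apply: has_order_uniq (h); apply: ordP (has_order_neq0 h). Qed.

Lemma order_geE n z : z != 0 -> order_ge n z <-> n <= ord z.
Proof.
move=> /ordP h; split=> [|le_n]; first exact: order_ge_le.
exact: order_geW le_n (has_order_ge h).
Qed.

Definition lder : L -> L := frac_der (@psder k).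

Lemma lder_leibniz : leibniz lder.
Proof. exact/frac_der_leibniz/psder_leibniz. Qed.

Lemma lder_tofrac (f : ps) : lder f%:F = (psder f)%:F.
Proof. exact/frac_der_tofrac/psder_leibniz. Qed.

Definition lC (c : k) : L := (psC c)%:F.

Fact lC_zmod : zmod_morphism lC.
Proof. by move=> a b; rewrite /lC !rmorphB. Qed.
Fact lC_monoid : monoid_morphism lC.
Proof. by split=> [|a b]; rewrite /lC ?rmorph1 // !rmorphM. Qed.
HB.instance Definition _ := GRing.isZmodMorphism.Build k L lC lC_zmod.
HB.instance Definition _ := GRing.isMonoidMorphism.Build k L lC lC_monoid.

Lemma lder_C c : lder (lC c) = 0.
Proof. by rewrite /lC lder_tofrac psder_poly derivC !rmorph0. Qed.

Lemma has_order_C c : c != 0 -> has_order 0 (lC c).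
Proof. by move=> c0; apply: has_order_unit; rewrite ct_C. Qed.

Lemma order_ge_C c : order_ge 0 (lC c).
Proof. exact: order_ge_tofrac. Qed.

End Laurent.

(** * Biquadratic extensions of k(w) *)

Section PolynomialEvaluation.

Variables (k : fieldType) (R : comNzRingType) (iota : {rmorphism k -> R}).

Definition pev (x : R) (p : {poly k}) : R := (map_poly iota p).[x].

Fact pev_zmod x : zmod_morphism (pev x).
Proof. by move=> p q; rewrite /pev rmorphB hornerD hornerN. Qed.
Fact pev_monoid x : monoid_morphism (pev x).
Proof. by split=> [|p q]; rewrite /pev ?rmorph1 ?hornerC // rmorphM hornerM. Qed.
HB.instance Definition _ x := GRing.isZmodMorphism.Build {poly k} R (pev x) (pev_zmod x).
HB.instance Definition _ x := GRing.isMonoidMorphism.Build {poly k} R (pev x) (pev_monoid x).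

Lemma pevC x c : pev x c%:P = iota c.
Proof. by rewrite /pev map_polyC hornerC. Qed.
Lemma pevX x : pev x 'X = x.
Proof. by rewrite /pev map_polyX hornerX. Qed.
Lemma pevE x (p : {poly k}) n : (size p <= n)%N -> pev x p = \sum_(i < n) iota p`_i * x ^+ i.
Proof.
move=> sp; rewrite /pev (@horner_coef_wide _ n) ?(leq_trans (size_poly _ _)) //.
by apply: eq_bigr => i _; rewrite coef_map.
Qed.

(** The reciprocal polynomial X^m p(1/X), where m may exceed the degree of [p]; it turns behaviour
    at w = oo into behaviour at 0. *)
Definition prev m (p : {poly k}) : {poly k} := \poly_(i < m.+1) p`_(m - i).

Lemma pev_prev m (p : {poly k}) x y : x * y = 1 -> (size p <= m.+1)%N ->
  pev x p * y ^+ m = pev y (prev m p).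
Proof.
move=> xy sp; rewrite (pevE _ sp) (@pevE _ _ m.+1) ?size_poly // big_distrl /=.
rewrite (reindex_inj rev_ord_inj) /=; apply: eq_bigr => i _.
rewrite coef_poly ltn_ord subSS -mulrA; congr (_ * _).
have -> : y ^+ m = y ^+ (m - i) * y ^+ i by rewrite -exprD subnK // -ltnS.
by rewrite mulrA -exprMn xy expr1n mul1r.
Qed.

Lemma prev0 m p : (prev m p)`_0 = p`_m.
Proof. by rewrite coef_poly subn0. Qed.

End PolynomialEvaluation.

Lemma rmorph_pev (k : fieldType) (R S : comNzRingType) (iota : {rmorphism k -> R})
    (psi : {rmorphism k -> S}) (phi : {rmorphism R -> S}) :
  (forall c, phi (iota c) = psi c) -> forall x p, phi (pev iota x p) = pev psi (phi x) p.
Proof.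
move=> h x p; rewrite !(@pevE _ _ _ _ _ (size p)) // rmorph_sum /=.
by apply: eq_bigr => i _; rewrite rmorphM rmorphXn /= h.
Qed.

Lemma two_neq0 (k R : fieldType) (iota : {rmorphism k -> R}) :
  (2 : k) != 0 -> (2 : R) != 0.
Proof. by rewrite -(fmorph_eq0 iota) rmorph_nat. Qed.

Section LaurentEvaluation.

Variable k : fieldType.
Local Notation L := (laurent k).
Local Notation "x %:F" := (FracField.tofrac x).

Lemma pev_tofrac (f : pseries k) p : pev (@lC k) f%:F p = (pev (@psC k) f p)%:F.
Proof. by rewrite (@rmorph_pev _ _ _ (@psC k) (@lC k) (@FracField.tofrac _)). Qed.

Lemma ct_pev (f : pseries k) p : ct (pev (@psC k) f p) = p.[ct f].
Proof.
rewrite (@rmorph_pev _ _ _ (@psC k) idfun (@ct k)); last exact: ct_C.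
by rewrite /pev map_poly_id.
Qed.

Lemma has_order_pev (W : L) (f : pseries k) c n p :
  W = f%:F -> ct f = c -> has_order n%:Z (W - lC c) -> p != 0 ->
  has_order (n * mup c p)%:Z (pev (@lC k) W p).
Proof.
move=> WE fc ordW p0; have [m [q qc pE]] := multiplicity_XsubC p c.
have q0 : q != 0 by apply: contraNneq p0 => q0; rewrite pE q0 mul0r.
move: qc; rewrite p0 /= => qc.
have -> : mup c p = m by rewrite pE mupMr // mup_XsubCX eqxx.
rewrite pE [pev _ _ _]rmorphM /= rmorphXn /= rmorphB /= pevX pevC -[(n * m)%:Z]add0r.
apply: has_orderM; first by rewrite WE pev_tofrac; apply: has_order_unit; rewrite ct_pev fc.
have -> : (n * m)%:Z = n%:Z *+ m by rewrite -mulr_natr natz PoszM.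
exact: has_orderX.
Qed.

Lemma has_order_pev_inv (p : {poly k}) : p != 0 ->
  has_order (- (size p).-1%:Z) (pev (@lC k) (lX k)^-1 p).
Proof.
move=> p0; exists (pev (@psC k) (psX k) (prev (size p).-1 p)).
rewrite ct_pev ct_X horner_coef0 prev0 -lead_coefE lead_coef_eq0; split=> //.
rewrite -pev_tofrac -(@pev_prev _ _ _ _ _ (lX k)^-1) ?mulVf ?lX_neq0 //; last first.
  by rewrite prednK ?size_poly_gt0.
by rewrite mulrC -invr_expz exprnP mulfK ?expfz_neq0 ?lX_neq0.
Qed.

Lemma has_order_inj (W : L) :
  (forall p, p != 0 -> exists n, has_order n (pev (@lC k) W p)) ->
  injective (pev (@lC k) W).
Proof.
move=> h; apply: raddf_inj => p /eqP; apply: contraTeq.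
by move=> /h[n /has_order_neq0].
Qed.

End LaurentEvaluation.

Section NonSquare.

Variable k : fieldType.
Local Notation "x %:F" := (FracField.tofrac x).

Lemma mup_simple_root (p : {poly k}) c :
  root p c -> ~~ root p^`() c -> mup c p = 1%N.
Proof.
move=> /factor_theorem[q ->]; rewrite derivM derivXsubC mulr1 /root !hornerE.
rewrite subrr mulr0 add0r => qc.
by rewrite mupMr // -[_ - _]expr1 mup_XsubCX eqxx.
Qed.

(** Embedding k(w) into Laurent series by w = c + x gives [p] order 1, whereas squares have even
    order. *)
Lemma nonsquare_simple_root (p : {poly k}) c :
  root p c -> ~~ root p^`() c -> forall x : {fraction {poly k}}, x ^+ 2 != p%:F.
Proof.
move=> pc p'c x; pose f := psC c + psX k; pose W : laurent k := (FracField.tofrac f).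
have fc : ct f = c by rewrite rmorphD /= ct_C ct_X addr0.
have ordW : has_order 1%N (W - lC c).
  by rewrite /W /f tofracD addrC addKr; exact: has_order_X.
have h q : q != 0 -> has_order (1 * mup c q)%:Z (pev (@lC k) W q).
  exact: has_order_pev.
have inj : injective (pev (@lC k) W).
  by apply: has_order_inj => q /h; exists (1 * mup c q)%N%:Z.
have p0 : p != 0 by apply: contraNneq p'c => ->; rewrite deriv0 root0.
apply: contraTneq isT => /(congr1 (frac_lift inj)).
rewrite rmorphXn /= frac_lift_tofrac => e.
have x0 : frac_lift inj x != 0.
  apply: contra (has_order_neq0 (h p p0)) => /eqP x0.
  by rewrite -e x0 expr0n.
have [n /(has_orderX 2)] := ex_order x0; rewrite e.
move=> /(has_order_uniq (h p p0)).
have -> : mup c p = 1%N by exact: mup_simple_root.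
by lia.
Qed.

End NonSquare.

(* Characterizes the field k(w)(y1, y2) together with its derivation d/dw. *)
Record biquadratic (k : fieldType) (f1 f2 : {poly k}) (K : fieldType)
    (iota : {rmorphism k -> K}) (w y1 y2 : K) (d : K -> K) : Prop := Biquadratic {
  bq_y1 : y1 ^+ 2 = pev iota w f1;
  bq_y2 : y2 ^+ 2 = pev iota w f2;
  bq_inj : injective (pev iota w);
  bq_decomp : forall z, exists (g p0 p1 p2 p3 : {poly k}), g != 0 /\
    z = (pev iota w p0 + pev iota w p1 * y1 + pev iota w p2 * y2
         + pev iota w p3 * (y1 * y2)) / pev iota w g;
  bq_lift : forall (L : fieldType) (psi : {rmorphism k -> L}) (W Y1 Y2 : L),
    injective (pev psi W) -> Y1 ^+ 2 = pev psi W f1 -> Y2 ^+ 2 = pev psi W f2 ->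
    exists phi : {rmorphism K -> L},
      [/\ forall c, phi (iota c) = psi c, phi w = W, phi y1 = Y1 & phi y2 = Y2];
  bq_leibniz : leibniz d;
  bq_dC : forall c, d (iota c) = 0;
  bq_dw : d w = 1 }.

Lemma common_denominator (k K : fieldType) (iota : {rmorphism k -> K}) (w y1 y2 : K)
    (a0 b0 a1 b1 a2 b2 a3 b3 : {poly k}) :
  injective (pev iota w) -> b0 != 0 -> b1 != 0 -> b2 != 0 -> b3 != 0 ->
  exists (g p0 p1 p2 p3 : {poly k}), g != 0 /\
    pev iota w a0 / pev iota w b0 + pev iota w a1 / pev iota w b1 * y1
      + pev iota w a2 / pev iota w b2 * y2 + pev iota w a3 / pev iota w b3 * (y1 * y2)
    = (pev iota w p0 + pev iota w p1 * y1 + pev iota w p2 * y2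
         + pev iota w p3 * (y1 * y2)) / pev iota w g.
Proof.
move=> inj n0 n1 n2 n3.
exists (b0 * b1 * b2 * b3), (a0 * (b1 * b2 * b3)), (a1 * (b0 * b2 * b3)),
  (a2 * (b0 * b1 * b3)), (a3 * (b0 * b1 * b2)).
split; first by rewrite !mulf_neq0.
have nz b : b != 0 -> pev iota w b != 0 by rewrite -(inj_eq inj) rmorph0.
move: (nz _ n0) (nz _ n1) (nz _ n2) (nz _ n3) => *; rewrite !rmorphM /=.
by field; do ?[apply/and4P; split | apply/andP; split].
Qed.

(** * Construction of the biquadratic field as a tower of two quadratic extensions *)

Section BiquadraticExists.

Variables (k : fieldType) (f1 f2 : {poly k}).
Local Notation "x %:F" := (FracField.tofrac x).
Local Notation F := {fraction {poly k}}.
Hypothesis two : (2 : k) != 0.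
Hypothesis nsq1 : forall x : F, x ^+ 2 != f1%:F.
Hypothesis nsq2 : forall x : F, x ^+ 2 != f2%:F.
Hypothesis nsq12 : forall x : F, x ^+ 2 != (f1 * f2)%:F.

Let toF : {rmorphism k -> F} := @FracField.tofrac _ \o @polyC k.

Fact twoF : (2 : F) != 0. Proof. exact: two_neq0 toF two. Qed.

Let K1 := qext nsq1.

Fact nsqF12 (x : F) : x ^+ 2 != f1%:F * f2%:F.
Proof. by rewrite -tofracM. Qed.

Fact nsqK1 (x : K1) : x ^+ 2 != qC nsq1 f2%:F.
Proof. exact: (qC_nonsquare twoF nsq2 nsqF12). Qed.

Let K := qext nsqK1.
Let iF : {rmorphism F -> K} := qC nsqK1 \o qC nsq1.
Let iota : {rmorphism k -> K} := iF \o toF.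
Let w : K := iF 'X%:F.
Let y1 : K := qC nsqK1 (qroot nsq1).
Let y2 : K := qroot nsqK1.

Let pev_iF p : pev iota w p = iF p%:F.
Proof.
rewrite /w -(@rmorph_pev _ _ _ toF iota iF) //; congr (iF _).
rewrite -(@rmorph_pev _ _ _ (@polyC k) toF (@FracField.tofrac _)) //.
by rewrite /pev -/(comp_poly 'X p) comp_polyXr.
Qed.

Let pev_inj : injective (pev iota w).
Proof. by move=> p q; rewrite !pev_iF => /fmorph_inj /eqP; rewrite tofrac_eq => /eqP. Qed.

Let iF_numden (x : F) : iF x = pev iota w (num x) / pev iota w (den x).
Proof. by rewrite !pev_iF {1}[x]num_den rmorphM fmorphV. Qed.

Let KE (z : K) : z = iF z.1.1 + iF z.1.2 * y1 + iF z.2.1 * y2 + iF z.2.2 * (y1 * y2).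
Proof. exact: qext_towerE. Qed.

Lemma biquadratic_exists : exists (K : fieldType) (iota : {rmorphism k -> K})
  (w y1 y2 : K) (d : K -> K), biquadratic f1 f2 iota w y1 y2 d.
Proof.
exists K, iota, w, y1, y2.
have derP : leibniz (@deriv k).
  by split=> p q; rewrite ?derivD // derivM addrC [_^`() * q]mulrC.
have derF := frac_der_leibniz derP; have der1 := qder_leibniz nsq1 derF twoF.
have two1 : (2 : K1) != 0 by exact: two_neq0 (qC nsq1) twoF.
exists (qder (qder (frac_der (@deriv k)))); split.
- by rewrite pev_iF /y1 -rmorphXn qrootE.
- by rewrite pev_iF /y2 qrootE.
- exact: pev_inj.
- move=> z; rewrite [z]KE !iF_numden.
  by apply: common_denominator pev_inj _ _ _ _; rewrite den_neq0.
- move=> L psi W Y1 Y2 inj e1 e2.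
  have E1 : Y1 ^+ 2 = frac_lift inj f1%:F by rewrite frac_lift_tofrac.
  have E2 : Y2 ^+ 2 = qlift E1 (qC nsq1 f2%:F) by rewrite qlift_C [RHS]frac_lift_tofrac.
  exists (qlift E2); split=> [c|||].
  + by rewrite /iota /= qlift_C [LHS]qlift_C [LHS]frac_lift_tofrac [LHS]pevC.
  + by rewrite /w /iF /= qlift_C [LHS]qlift_C [LHS]frac_lift_tofrac [LHS]pevX.
  + by rewrite [LHS]qlift_C [LHS]qlift_root.
  + exact: qlift_root.
- exact: qder_leibniz der1 two1.
- move=> c; rewrite [LHS](qder_C nsqK1 der1) [X in qC nsqK1 X](qder_C nsq1 derF).
  by rewrite frac_der_tofrac // derivC !rmorph0.
- rewrite [LHS](qder_C nsqK1 der1) [X in qC nsqK1 X](qder_C nsq1 derF).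
  by rewrite frac_der_tofrac // derivX !rmorph1.
Qed.

End BiquadraticExists.

(** * Differentials and transcendence degree *)

Section GeneralAlgebra.

Lemma rmorph_mmap (k R S : comNzRingType) n (f : {rmorphism k -> R}) (g : {rmorphism k -> S})
    (phi : {rmorphism R -> S}) (h : 'I_n -> R) (h' : 'I_n -> S) (p : {mpoly k[n]}) :
  (forall c, phi (f c) = g c) -> (forall i, phi (h i) = h' i) ->
  phi (mmap f h p) = mmap g h' p.
Proof.
move=> fg hh; rewrite /mmap rmorph_sum /=; apply: eq_bigr => m _.
rewrite rmorphM /= fg /mmap1 rmorph_prod /=; congr (_ * _).
by apply: eq_bigr => i _; rewrite rmorphXn /= hh.
Qed.

Lemma mmap_id (k : comNzRingType) n (p : {mpoly k[n]}) :
  mmap (@mpolyC n k) (fun i => 'X_i) p = p.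
Proof.
rewrite -[RHS](comp_mpoly_id p) /comp_mpoly /mmap; apply: eq_bigr => m _.
by congr (_ * _); apply: mmap1_eq => i; rewrite tnth_mktuple.
Qed.

Lemma pev_polyC (k : fieldType) (p : {poly k}) : pev (@polyC k) 'X p = p.
Proof. exact: comp_polyXr. Qed.

(** A relation P(x, y) = 0 can be read over k[x] or over k[y]: this turns algebraicity of x over
    k(w) into algebraicity of w over k(x). *)
Lemma pev_swap (k : fieldType) (R : comNzRingType) (iota : {rmorphism k -> R})
    (P : {poly {poly k}}) x y :
  (map_poly (pev iota x) P).[y] = (map_poly (pev iota y) (swapXY P)).[x].
Proof.
have E z Q : map_poly (pev iota z) Q = map_poly (horner_eval z) (map_poly (map_poly iota) Q).
  by rewrite -map_poly_comp.
by rewrite !E -swapXY_map -horner_swapXY -horner_polyC horner2_swapXY.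
Qed.

Lemma clear_denominator_step (F : fieldType) (a b n : F) (p : {poly F}) : b != 0 ->
  a%:P * p * 'X * b%:P + a%:P * n%:P =
  a%:P * b%:P * (p * 'X) + a%:P * b%:P * (n / b)%:P.
Proof.
move=> b0; have -> : n%:P = b%:P * (n / b)%:P by rewrite -rmorphM /= mulrC divfK.
by ring.
Qed.

Lemma clear_denominators (R : idomainType) (p : {poly {fraction R}}) :
  exists (g : R) (P : {poly R}), g != 0 /\
    map_poly (@FracField.tofrac R) P = (FracField.tofrac g) *: p.
Proof.
elim/poly_ind: p => [|p c [g [P [g0 e]]]].
  by exists 1, 0; rewrite oner_neq0 rmorph0 scaler0.
exists (g * den c), (P * 'X * (den c)%:P + (g * num c)%:P).
rewrite mulf_neq0 ?den_neq0 //; split=> //.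
rewrite rmorphD !rmorphM /= !map_polyC map_polyX /= e.
rewrite scalerDr -!mul_polyC !rmorphM /=.
have -> : c%:P = (FracField.tofrac (num c) / FracField.tofrac (den c))%:P by rewrite -num_den.
have : FracField.tofrac (den c) != 0 by rewrite tofrac_eq0 den_neq0.
move: (FracField.tofrac g) (FracField.tofrac (den c)) (FracField.tofrac (num c)) => a b n b0.
exact: clear_denominator_step.
Qed.

Lemma algebraic_frac (R : idomainType) (L : fieldType) (phi : {rmorphism R -> L})
    (inj : injective phi) u :
  algebraicOver (frac_lift inj) u <->
  exists2 P : {poly R}, P != 0 & root (map_poly phi P) u.
Proof.
have E (P : {poly R}) :
  map_poly (frac_lift inj) (map_poly (@FracField.tofrac R) P) = map_poly phi P.
  by rewrite -map_poly_comp; apply: eq_map_poly => a /=; rewrite frac_lift_tofrac.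
split=> [[p p0 pu]|[P P0 Pu]]; last first.
  exists (map_poly (@FracField.tofrac R) P); rewrite ?E //.
  by rewrite map_poly_eq0_id0 // tofrac_eq0 lead_coef_eq0.
have [g [P [g0 e]]] := clear_denominators p; exists P.
  apply: contraNneq p0 => P0; move: e; rewrite P0 rmorph0 => /esym/eqP.
  by rewrite scaler_eq0 tofrac_eq0 (negPf g0).
by rewrite -E e linearZ /= /root hornerZ (eqP (pu : _.[u] == 0)) mulr0.
Qed.

Lemma algebraic_sqrt (F L : fieldType) (phi : {rmorphism F -> L}) x :
  algebraicOver phi (x ^+ 2) -> algebraicOver phi x.
Proof.
move=> [p p0 px]; exists (p \Po 'X^2); last first.
  by rewrite map_comp_poly map_polyXn /root horner_comp hornerXn.
by rewrite comp_poly_eq0 ?size_polyXn.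
Qed.

End GeneralAlgebra.

Section FunctionField.

Variables (k : fieldType) (f1 f2 : {poly k}) (K : fieldType) (iota : {rmorphism k -> K}).
Variables (w y1 y2 : K) (d : K -> K).
Hypothesis bq : biquadratic f1 f2 iota w y1 y2 d.
Hypothesis two : (2 : k) != 0.
Hypotheses (f1_neq0 : f1 != 0) (f2_neq0 : f2 != 0).

Lemma pev_closed (P : K -> Prop) :
  (forall c, P (iota c)) -> P w -> (forall x y, P x -> P y -> P (x + y)) ->
  (forall x y, P x -> P y -> P (x * y)) -> forall p, P (pev iota w p).
Proof.
move=> PC Pw PD PM; elim/poly_ind => [|p c IH].
  by rewrite rmorph0 -(rmorph0 iota).
by rewrite rmorphD rmorphM /= pevX pevC; apply: PD => //; apply: PM.
Qed.

(** Serves three times: to compare derivations, to propagate algebraicity, and to exhibit elements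
    as quotients of forms. *)
Lemma bq_ind (P : K -> Prop) :
  (forall c, P (iota c)) -> P w -> P y1 -> P y2 ->
  (forall x y, P x -> P y -> P (x + y)) -> (forall x y, P x -> P y -> P (x * y)) ->
  (forall x, x != 0 -> P x -> P x^-1) -> forall z, P z.
Proof.
move=> PC Pw P1 P2 PD PM PV z; have Pp := pev_closed PC Pw PD PM.
have [g [p0 [p1 [p2 [p3 [g0 ->]]]]]] := bq_decomp bq z.
apply: (PM); last by apply: PV (Pp _); rewrite -(inj_eq (bq_inj bq)) rmorph0 in g0 *.
by do !apply: (PD); do ?apply: (PM).
Qed.

Lemma y1_neq0 : y1 != 0.
Proof.
apply: contraNneq f1_neq0 => y0.
by rewrite -(inj_eq (bq_inj bq)) rmorph0 -(bq_y1 bq) y0 expr0n.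
Qed.

Lemma y2_neq0 : y2 != 0.
Proof.
apply: contraNneq f2_neq0 => y0.
by rewrite -(inj_eq (bq_inj bq)) rmorph0 -(bq_y2 bq) y0 expr0n.
Qed.

Lemma is_derivation_d : @is_derivation k K iota K^o d.
Proof.
have [dD dM] := bq_leibniz bq.
by split=> [x y|x y|c]; [exact: dD|exact: dM|exact: bq_dC bq c].
Qed.

Section Derivation.

Variables (M : lmodType K) (D : K -> M).
Hypothesis derD : is_derivation iota D.

Lemma derivation1 : D 1 = 0.
Proof. by rewrite -(rmorph1 iota) (derivationC derD). Qed.

Lemma derivationV x : x != 0 -> D x^-1 = - (x ^- 2 *: D x).
Proof.
move=> x0; have := derivationM derD x x^-1; rewrite mulfV // derivation1.
move=> /esym /eqP; rewrite addrC addr_eq0 => /eqP e.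
by rewrite -[D _]scale1r -(mulVf x0) -scalerA -[x *: _]opprK -e scalerN scalerA -invfM -expr2.
Qed.

Lemma derivation_sqr x : D (x ^+ 2) = (2 * x) *: D x.
Proof. by rewrite expr2 (derivationM derD) -scalerDl mulr_natl mulr2n. Qed.

End Derivation.

(** Both sides agree on constants and on w. They agree on y1 and y2 because their squares are
    polynomials in w and D(y^2) = 2 y D y with 2 y invertible. *)
Lemma derivation_dw (M : lmodType K) (D : K -> M) : is_derivation iota D ->
  forall z, D z = d z *: D w.
Proof.
move=> derD; have derd := is_derivation_d.
pose P z := D z = d z *: D w.
have PC c : P (iota c) by rewrite /P (derivationC derD) (bq_dC bq) scale0r.
have Pw : P w by rewrite /P (bq_dw bq) scale1r.
have PD x y : P x -> P y -> P (x + y).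
  by rewrite /P (derivationD derD) (derivationD derd) scalerDl => -> ->.
have PM x y : P x -> P y -> P (x * y).
  by rewrite /P (derivationM derD) (derivationM derd) scalerDl -!scalerA => -> ->.
have Psqrt y : y != 0 -> P (y ^+ 2) -> P y.
  rewrite /P (derivation_sqr derD) (derivation_sqr derd) => y0.
  have -> : ((2 * y) *: (d y : K^o)) *: D w = (2 * y) *: (d y *: D w) by rewrite scalerA.
  by apply: scalerI; rewrite mulf_neq0 ?(two_neq0 iota).
apply: bq_ind => //.
- apply: Psqrt y1_neq0 _; rewrite (bq_y1 bq); exact: pev_closed.
- apply: Psqrt y2_neq0 _; rewrite (bq_y2 bq); exact: pev_closed.
move=> x x0; rewrite /P (derivationV derD) // (derivationV derd) // => ->.
by rewrite scaleNr scalerA.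
Qed.

Section ScaleAt.
Variables (M : lmodType K) (v : M).
Definition scale_at (x : K^o) : M := x *: v.
Fact scale_at_linear : linear scale_at.
Proof. by move=> a x y; rewrite /scale_at scalerDl scalerA. Qed.
HB.instance Definition _ := GRing.isLinear.Build K K^o M *:%R scale_at scale_at_linear.
End ScaleAt.

(** By [derivation_dw] the differentials are free on dw, which is the element 1 of [K^o]. *)
Lemma is_kaehler_d : @is_kaehler k K iota K^o d.
Proof.
split; first exact: is_derivation_d.
move=> M D derD; exists (scale_at (D w)); split=> [z|psi h z].
  exact: derivation_dw.
have e := h w; rewrite (bq_dw bq) in e.
by rewrite /= /scale_at e -linearZ /= /GRing.scale /= mulr1.
Qed.

Lemma alg_independent_w : alg_independent iota (fun _ : 'I_1 => w).
Proof.
move=> p e; pose q := mmap (@polyC k) (fun _ : 'I_1 => 'X) p.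
have : pev iota w q = 0.
  rewrite -e /q; apply: rmorph_mmap => [c|i]; [exact: pevC | exact: pevX].
move=> /eqP; rewrite -(rmorph0 (pev iota w)) (inj_eq (bq_inj bq)) => /eqP q0.
rewrite -[p]mmap_id; have <- : pev (@mpolyC 1 k) 'X_ord0 q = mmap (@mpolyC 1 k) (fun i => 'X_i) p.
  by apply: rmorph_mmap => [c|i]; [exact: pevC | rewrite (ord1 i); exact: pevX].
by rewrite q0 rmorph0.
Qed.

Lemma all_algebraic (F : fieldType) (phi : {rmorphism F -> K}) :
  (forall c, algebraicOver phi (iota c)) -> algebraicOver phi w ->
  forall z, algebraicOver phi z.
Proof.
move=> aC aw; have aD := @algebraic_add _ _ phi; have aM := @algebraic_mul _ _ phi.
apply: bq_ind => //.
- by apply: algebraic_sqrt; rewrite (bq_y1 bq); exact: pev_closed.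
- by apply: algebraic_sqrt; rewrite (bq_y2 bq); exact: pev_closed.
by move=> x _; exact: algebraic_inv.
Qed.

(** Exchange argument: x0 is transcendental over k and algebraic over k(w), so w, and with it all of
    K, is algebraic over k(x0). Hence x1 satisfies a nonzero relation [P] over k[x0]. *)
Lemma not_alg_independent2 (x : 'I_2 -> K) : ~ alg_independent iota x.
Proof.
move=> ind; pose i0 : 'I_2 := ord0; pose i1 : 'I_2 := ord_max.
have inj : injective (pev iota (x i0)).
  apply: raddf_inj => p e.
  have p0 : pev (@mpolyC 2 k) 'X_i0 p = 0.
    apply: ind; rewrite -[RHS]e (@rmorph_pev _ _ _ _ iota) => [|c]; last exact: mmapC.
    by rewrite /= mmapX mmap1U.
  rewrite -[p]pev_polyC; have := congr1 (mmap (@polyC k) (fun=> 'X)) p0.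
  rewrite rmorph0 => <-; rewrite (@rmorph_pev _ _ _ _ (@polyC k)) => [|c]; last exact: mmapC.
  by rewrite /= mmapX mmap1U.
have aw : algebraicOver (frac_lift inj) w.
  apply/algebraic_frac.
  have : algebraicOver (frac_lift (bq_inj bq)) (x i0).
    apply: all_algebraic => [c|].
      have := algebraic_id (frac_lift (bq_inj bq)) (FracField.tofrac c%:P).
      by rewrite /= frac_lift_tofrac /= pevC.
    have := algebraic_id (frac_lift (bq_inj bq)) (FracField.tofrac 'X).
    by rewrite /= frac_lift_tofrac /= pevX.
  move=> /algebraic_frac[P P0 Px]; exists (swapXY P); first by rewrite swapXY_eq0.
  by rewrite /root -pev_swap.
have : algebraicOver (frac_lift inj) (x i1).
  apply: all_algebraic aw _ => c.
  have := algebraic_id (frac_lift inj) (FracField.tofrac c%:P).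
  by rewrite /= frac_lift_tofrac /= pevC.
move=> /algebraic_frac[P P0 Px].
(* [M] is [P] rewritten as a polynomial in two variables; independence will give M = 0. *)
pose M := (map_poly (pev (@mpolyC 2 k) 'X_i0) P).['X_i1].
have ev (S : comNzRingType) (g : {rmorphism k -> S}) (h : 'I_2 -> S) :
  mmap g h M = (map_poly (pev g (h i0)) P).[h i1].
  rewrite /M -horner_map /= -map_poly_comp mmapX mmap1U; congr (_.[_]).
  apply: eq_map_poly => p /=; rewrite (@rmorph_pev _ _ _ _ g) => [|c]; last exact: mmapC.
  by rewrite /= mmapX mmap1U.
have M0 : M = 0 by apply: ind; rewrite ev; exact/eqP.
(* Substituting the inner variable for X_0 and the outer one for X_1 recovers [P] from [M]. *)
pose g : {rmorphism k -> {poly {poly k}}} := @polyC _ \o @polyC k.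
have := ev _ g (fun i => if i == i0 then 'X%:P else 'X).
rewrite M0 rmorph0 /= => e; case/eqP: P0; rewrite -[LHS]comp_polyXr [RHS]e.
rewrite /comp_poly; congr (_.[_]); apply: eq_map_poly => p.
by rewrite -{1}[p]pev_polyC (@rmorph_pev _ _ _ (@polyC k) g).
Qed.

Lemma has_trdeg1 : has_trdeg iota 1.
Proof.
split; first by exists (fun=> w); exact: alg_independent_w.
by case=> x; exact: not_alg_independent2.
Qed.

End FunctionField.

(** * Regular differentials *)

Section Valuation.

Variables (k K : fieldType) (iota : {rmorphism k -> K}) (v : K -> int).
Hypothesis vv : is_valuation iota v.

Local Notation O := (valuation_ring v).
Definition max_ideal (x : K) : Prop := x = 0 \/ 0 < v x.
Local Notation m := max_ideal.

Lemma val1 : v 1 = 0.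
Proof. by rewrite -(rmorph1 iota) (valuationC vv) // oner_eq0. Qed.

Lemma valV x : x != 0 -> v x^-1 = - v x.
Proof.
move=> x0; apply/eqP; rewrite -addr_eq0 -(valuationM vv) ?invr_eq0 //.
by rewrite mulVf // val1.
Qed.

Lemma vringC c : O (iota c).
Proof.
have [->|c0] := eqVneq c 0; first by left; rewrite rmorph0.
by right; rewrite (valuationC vv).
Qed.

Lemma vringM x y : O x -> O y -> O (x * y).
Proof.
have [->|x0] := eqVneq x 0; first by left; rewrite mul0r.
have [->|y0] := eqVneq y 0; first by left; rewrite mulr0.
case=> [/eqP|vx]; first by rewrite (negPf x0).
case=> [/eqP|vy]; first by rewrite (negPf y0).
by right; rewrite (valuationM vv) // addr_ge0.
Qed.

Lemma vringD x y : O x -> O y -> O (x + y).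
Proof.
have [->|x0] := eqVneq x 0; first by rewrite add0r.
have [->|y0] := eqVneq y 0; first by rewrite addr0.
have [->|xy0] := eqVneq (x + y) 0; first by left.
case=> [/eqP|vx]; first by rewrite (negPf x0).
case=> [/eqP|vy]; first by rewrite (negPf y0).
by right; apply: le_trans (valuationD vv x0 y0 xy0); rewrite le_min vx.
Qed.

Lemma vringX x n : O x -> O (x ^+ n).
Proof.
move=> Ox; elim: n => [|n IH]; last by rewrite exprS; exact: vringM.
by rewrite expr0 -(rmorph1 iota); exact: vringC.
Qed.

Lemma vring_pev x p : O x -> O (pev iota x p).
Proof.
move=> Ox; elim/poly_ind: p => [|p c IH]; first by rewrite rmorph0; left.
rewrite rmorphD rmorphM /= pevX pevC; apply: vringD (vringC c).
exact: vringM.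
Qed.

Lemma max_idealD x y : m x -> m y -> m (x + y).
Proof.
have [->|x0] := eqVneq x 0; first by rewrite add0r.
have [->|y0] := eqVneq y 0; first by rewrite addr0.
have [->|xy0] := eqVneq (x + y) 0; first by left.
case=> [/eqP|vx]; first by rewrite (negPf x0).
case=> [/eqP|vy]; first by rewrite (negPf y0).
by right; apply: lt_le_trans (valuationD vv x0 y0 xy0); rewrite lt_min vx.
Qed.

Lemma max_idealM x y : O x -> m y -> m (x * y).
Proof.
have [->|x0] := eqVneq x 0; first by left; rewrite mul0r.
have [->|y0] := eqVneq y 0; first by left; rewrite mulr0.
case=> [/eqP|vx]; first by rewrite (negPf x0).
case=> [/eqP|vy]; first by rewrite (negPf y0).
by right; rewrite (valuationM vv) // ltr_wpDl.
Qed.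

Lemma max_ideal_vring x : m x -> O x.
Proof. by case=> [->|vx]; [left | right; exact: ltW]. Qed.

Lemma max_idealN x : m x -> m (- x).
Proof.
rewrite -mulN1r -(rmorph1 iota) -rmorphN; exact: max_idealM (vringC _).
Qed.

Lemma max_ideal_iota c : m (iota c) -> c = 0.
Proof.
case=> [/eqP|]; first by rewrite fmorph_eq0 => /eqP.
by apply: contraTeq => c0; rewrite (valuationC vv).
Qed.

Lemma max_ideal1 : ~ m 1.
Proof. by rewrite -(rmorph1 iota) => /max_ideal_iota/eqP; rewrite oner_eq0. Qed.

Lemma vring_unit x : O x -> m x \/ O x^-1.
Proof.
case=> [->|]; first by left; left.
have [->|x0] := eqVneq x 0; first by left; left.
rewrite le_eqVlt => /orP[/eqP vx|vx]; last by left; right.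
by right; right; rewrite valV // -vx.
Qed.

Lemma not_vring x : ~ O x -> x != 0 /\ m x^-1.
Proof.
move=> nO; have x0 : x != 0 by apply/eqP => x0; apply: nO; left.
split=> //; right; rewrite valV // oppr_gt0 ltNge.
by apply/negP => vx; apply: nO; right.
Qed.

Lemma vring_sqr x : O (x ^+ 2) -> O x.
Proof.
have [->|x0] := eqVneq x 0; first by left.
case=> [/eqP|]; first by rewrite expf_eq0 (negPf x0) andbF.
by rewrite expr2 (valuationM vv) // => vx; right; lia.
Qed.

End Valuation.

Section RegularBasis.

Variables (k : fieldType) (f1 f2 : {poly k}) (K : fieldType) (iota : {rmorphism k -> K}).
Variables (w y1 y2 : K) (d : K -> K).
Hypothesis bq : biquadratic f1 f2 iota w y1 y2 d.

Lemma d_pev p : d (pev iota w p) = pev iota w p^`().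
Proof.
have [dD dM] := bq_leibniz bq.
elim/poly_ind: p => [|p c IH].
  by rewrite deriv0 !rmorph0 -(rmorph0 iota) (bq_dC bq) rmorph0.
rewrite derivD derivM derivX derivC addr0 mulr1 !rmorphD !rmorphM /= !pevX pevC.
by rewrite dD dM (bq_dC bq) (bq_dw bq) IH; ring.
Qed.

Lemma regular_at_scale (v : K -> int) (a x : K) :
  valuation_ring v a -> valuation_ring v x -> @regular_at K K^o d v (a * d x).
Proof.
move=> Oa Ox; exists [:: (a, x)]; split; last by rewrite big_seq1.
by move=> p; rewrite inE => /eqP ->.
Qed.

(* If y^2 = f(w) vanishes at a place where w is finite, then f'(w) is a unit there
   and dw / y = 2 dy / f'(w); at a place over w = oo one uses dw = - w^2 d(1/w). *)
Lemma regular_basis (f : {poly k}) (y : K) n i :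
  y ^+ 2 = pev iota w f -> coprimep f f^`() -> size f = n.*2.+1 -> (i < n.-1)%N ->
  @is_regular_form k K iota K^o d (w ^+ i / y).
Proof.
move=> yE cop sf lt_in v vv.
have f0 : f != 0 by rewrite -size_poly_gt0 sf.
have y0 : y != 0.
  apply: contraNneq f0 => y0.
  by rewrite -(inj_eq (bq_inj bq)) rmorph0 -yE y0 expr0n.
have [dD dM] := bq_leibniz bq.
have [Ow|/(not_vring vv)[w0 mx]] := pselect (valuation_ring v w).
  have Oy : valuation_ring v y by apply: (vring_sqr vv); rewrite yE; exact: (vring_pev vv).
  have [my|Oy1] := vring_unit vv Oy; last first.
    have -> : w ^+ i / y = w ^+ i / y * d w by rewrite (bq_dw bq) mulr1.
    by apply: regular_at_scale => //; apply: (vringM vv) => //; exact: (vringX vv).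
  have [[U V] /= UV] := Bezout_eq1_coprimepP _ _ cop.
  have [mf'|Of'] := vring_unit vv (vring_pev vv f^`() Ow).
    case: (max_ideal1 vv); rewrite -(rmorph1 (pev iota w)) -UV rmorphD !rmorphM /=.
    apply: (max_idealD vv); apply: (max_idealM vv) => //; try exact: (vring_pev vv).
    by rewrite -yE expr2; exact: (max_idealM vv).
  have dy : 2 * y * d y = pev iota w f^`().
    by rewrite -d_pev -yE expr2 dM; ring.
  have f'0 : pev iota w f^`() != 0.
    apply/eqP => f'0; move: UV => /(congr1 (pev iota w)).
    rewrite rmorphD !rmorphM /= f'0 mulr0 addr0 rmorph1 -yE => e.
    apply: (max_ideal1 vv); rewrite -e; apply: (max_idealM vv); first exact: (vring_pev vv).
    by rewrite expr2; exact: (max_idealM vv).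
  have -> : w ^+ i / y = w ^+ i * 2 / pev iota w f^`() * d y.
    move: (f'0); rewrite -dy !mulf_eq0 !negb_or => /andP[/andP[n2 _] dy0].
    by field; rewrite dy0 y0.
  apply: regular_at_scale => //; apply: (vringM vv) => //; apply: (vringM vv).
    exact: (vringX vv).
  by rewrite -(rmorph_nat iota); exact: (vringC vv).
set x := w^-1 in mx *; have Ox := max_ideal_vring mx.
have wx : w * x = 1 by rewrite mulfV.
have dx : d x = - x ^+ 2.
  have := dM w x; rewrite wx (bq_dw bq) mulr1 -(rmorph1 iota) (bq_dC bq) => e.
  have : x * (w * d x + x) = 0 by rewrite -e mulr0.
  by rewrite mulrDr mulrA (mulrC x w) wx mul1r -expr2 => /eqP; rewrite addr_eq0 => /eqP.
pose Y := y * x ^+ n.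
have YE : Y ^+ 2 = pev iota x (prev n.*2 f).
  by rewrite exprMn yE -exprM muln2 (pev_prev _ wx) // sf.
have Ox2 := vring_pev vv (prev n.*2 f) Ox.
have OY : valuation_ring v Y by apply: (vring_sqr vv); rewrite YE.
have [mY|OY1] := vring_unit vv OY.
  (* Y = y / w^n satisfies Y^2 = x^(2n) f(1/x), with residue the leading coefficient of f; Y in the
     maximal ideal would make that coefficient vanish. *)
  have lead : f`_n.*2 = 0.
    apply: (max_ideal_iota vv).
    have -> : iota f`_n.*2 = Y ^+ 2 - pev iota x (prev n.*2 f - (f`_n.*2)%:P).
      by rewrite YE rmorphB /= pevC; ring.
    have [q ->] : exists q, prev n.*2 f - (f`_n.*2)%:P = q * 'X.
      have : root (prev n.*2 f - (f`_n.*2)%:P) 0.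
        by rewrite /root hornerD hornerN hornerC horner_coef0 prev0 subrr.
      by move=> /factor_theorem[q ->]; exists q; rewrite subr0.
    apply: (max_idealD vv); first by rewrite expr2; exact: (max_idealM vv).
    apply: (max_idealN vv); rewrite rmorphM /= pevX.
    by apply: (max_idealM vv) => //; exact: (vring_pev vv).
  by case/eqP: f0; apply/eqP; rewrite -lead_coef_eq0 /lead_coef sf /= lead.
(* Since 1 / y = x^n / Y and dw = - x^-2 dx, the hypothesis i < n - 1 is what makes the exponent n -
   i - 2 nonnegative. *)
have -> : w ^+ i / y = - x ^+ (n - i.+2) / Y * d x.
  have -> : y = Y * w ^+ n by rewrite /Y -mulrA -exprMn mulrC (mulrC x) wx expr1n mul1r.
  have Y0 : Y != 0 by rewrite mulf_neq0 // expf_neq0 // invr_eq0.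
  have -> : w ^+ n = w ^+ (n - i.+2) * w ^+ i * w ^+ 2 by rewrite -!exprD; congr (_ ^+ _); lia.
  rewrite dx /x !exprVn.
  have := expf_neq0 i w0; have := expf_neq0 (n - i.+2) w0; move: (w ^+ i) (w ^+ (n - _)).
  by move=> a b a0 b0; field; do ?[apply/and4P; split|apply/and3P; split | apply/andP; split].
apply: regular_at_scale => //; apply: (vringM vv) => //.
rewrite -mulN1r; apply: (vringM vv); last exact: (vringX vv).
by rewrite -(rmorph1 iota) -rmorphN; exact: (vringC vv).
Qed.

End RegularBasis.

(** * Laurent expansions *)

Lemma closed_sqrt (k : closedFieldType) (c : k) : exists r, r ^+ 2 = c.
Proof.
have /closed_rootP[r] : size ('X^2 - c%:P) != 1%N by rewrite size_XnsubC.
by rewrite /root !hornerE subr_eq0 => /eqP; exists r.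
Qed.

Lemma laurent_sqrt (k : closedFieldType) (z : laurent k) (n : int) : (2 : k) != 0 ->
  has_order (n + n) z -> exists2 y, y ^+ 2 = z & has_order n y.
Proof.
move=> two [u [u0 ->]]; have [r rE] := closed_sqrt (ct u).
have r0 : r != 0 by apply: contraNneq u0 => r0; rewrite -rE r0 expr0n.
have [g gE gr] := ps_sqrt r0 two (esym rE).
exists (lX k ^ n * FracField.tofrac g); last by exists g; rewrite gr.
by rewrite exprMn -tofracXn gE expr2 expfzDr ?lX_neq0.
Qed.

Lemma dvdp_mup (k : closedFieldType) (g q : {poly k}) : g != 0 -> q != 0 ->
  (forall c, (mup c g <= mup c q)%N) -> g %| q.
Proof.
have [n] := ubnP (size g); elim: n g q => // n IH g q; rewrite ltnS => sg g0 q0 h.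
have [/eqP sg1|/closed_rootP[c gc]] := boolP (size g == 1%N).
  by move/eqP: sg1; rewrite -dvdp1 => /dvdp_trans; apply; exact: dvd1p.
have [g' gE] := factor_theorem _ _ gc.
have mg : (0 < mup c g)%N by rewrite -XsubC_dvd // dvdp_XsubCl.
have : (0 < mup c q)%N by exact: leq_trans (h c).
rewrite -XsubC_dvd // dvdp_XsubCl => /factor_theorem[q' qE].
have X0 : 'X - c%:P != 0 by rewrite polyXsubC_eq0.
have g'0 : g' != 0 by apply: contraNneq g0 => g'0; rewrite gE g'0 mul0r.
have q'0 : q' != 0 by apply: contraNneq q0 => q'0; rewrite qE q'0 mul0r.
rewrite gE qE dvdp_mul2r //; apply: IH => // [|b].
  by move: sg; rewrite gE size_Mmonic ?monicXsubC // size_XsubC addn2.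
by have := h b; rewrite gE qE !mupM // leq_add2r.
Qed.

(** Fourier inversion on the group (Z/2)^2 of sign changes. *)
Lemma sign_average (R : comNzRingType) (x0 x1 x2 x3 : R)
  (F := fun s1 s2 : bool => x0 + (-1) ^+ s1 * x1 + (-1) ^+ s2 * x2
     + (-1) ^+ s1 * (-1) ^+ s2 * x3) :
  [/\ 4 * x0 = (F false false + F false true) + (F true false + F true true),
      4 * x1 = (F false false + F false true) - (F true false + F true true),
      4 * x2 = (F false false + F true false) - (F false true + F true true)
    & 4 * x3 = (F false false + F true true) - (F false true + F true false)].
Proof. by rewrite /F !expr0 !expr1; split; ring. Qed.

Section Pullback.

Variables (K L : fieldType) (phi : {rmorphism K -> L}).

(* A derivation of L composed with phi is a derivation of K into this K-module. *)
Definition pullback of {rmorphism K -> L} : Type := L.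
Local Notation V := (pullback phi).

HB.instance Definition _ := GRing.Zmodule.copy V L.

Definition pullback_scale (a : K) (x : V) : V := (phi a * x : L).

Fact pullback_scaleA a b (x : V) :
  pullback_scale a (pullback_scale b x) = pullback_scale (a * b) x.
Proof. by rewrite /pullback_scale rmorphM mulrA. Qed.
Fact pullback_scale1 : left_id 1 pullback_scale.
Proof. by move=> x; rewrite /pullback_scale rmorph1 mul1r. Qed.
Fact pullback_scaleDr : right_distributive pullback_scale +%R.
Proof. by move=> a x y; exact: mulrDr. Qed.
Fact pullback_scaleDl (x : V) : {morph pullback_scale^~ x : a b / a + b}.
Proof. by move=> a b; rewrite /pullback_scale rmorphD; exact: mulrDl. Qed.

HB.instance Definition _ := GRing.Zmodule_isLmodule.Build K V
  pullback_scaleA pullback_scale1 pullback_scaleDr pullback_scaleDl.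

End Pullback.

Section LocalEmbeddings.

Variables (k : closedFieldType) (f1 f2 : {poly k}) (K : fieldType) (iota : {rmorphism k -> K}).
Variables (w y1 y2 : K) (d : K -> K).
Hypothesis bq : biquadratic f1 f2 iota w y1 y2 d.
Hypothesis two : (2 : k) != 0.
Hypotheses (f1_neq0 : f1 != 0) (f2_neq0 : f2 != 0).
Local Notation L := (laurent k).

Section Valuation.

Variable phi : {rmorphism K -> L}.
Hypothesis phiC : forall c, phi (iota c) = lC c.

(** An element of order 1 is asked for because valuations are normalized: w = c + x^2 alone only
    produces even orders from k(w). *)
Lemma is_valuation_ord (u : K) : has_order 1 (phi u) ->
  is_valuation iota (fun x => ord (phi x)).
Proof.
move=> ou; have P x : x != 0 -> has_order (ord (phi x)) (phi x).
  by move=> x0; apply: ordP; rewrite fmorph_eq0.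
split=> [x y x0 y0|x y x0 y0 xy0|c c0|].
- by apply: ordE; rewrite rmorphM; apply: has_orderM; exact: P.
- apply/order_geE; first by rewrite fmorph_eq0.
  rewrite rmorphD; apply: order_geD; apply: order_geW (has_order_ge (P _ _)) => //.
    by rewrite ge_min lexx.
  by rewrite ge_min lexx orbT.
- by apply: ordE; rewrite phiC; exact: has_order_C.
exists u; last exact: ordE.
by have := has_order_neq0 ou; rewrite fmorph_eq0.
Qed.

(** Chain rule dz/dx = (dz/dw)(dw/dx): [lder] after [phi] is a derivation into [pullback phi], so
    [derivation_dw] applies. *)
Lemma phi_d z : phi (d z) * lder (phi w) = lder (phi z).
Proof.
pose D (x : K) : pullback phi := lder (phi x).
have [lD lM] := lder_leibniz k.
have derD : is_derivation iota D.
  split=> [x y|x y|c]; rewrite /D ?rmorphD ?rmorphM ?phiC.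
  - exact: lD.
  - exact: lM.
  - exact: lder_C.
by rewrite -[RHS]/(D z) (derivation_dw bq two f1_neq0 f2_neq0 derD).
Qed.

(** A term a db with a, b in the valuation ring becomes a power series times the derivative of a
    power series, so a regular differential has no pole in x. *)
Lemma regular_order (u f : K) : has_order 1 (phi u) ->
  @is_regular_form k K iota K^o d f -> order_ge 0 (phi f * lder (phi w)).
Proof.
move=> ou /(_ _ (is_valuation_ord ou)) [s [sO ->]].
rewrite rmorph_sum mulr_suml; apply: order_ge_sum => p ps.
have vO x : valuation_ring (fun x => ord (phi x)) x -> order_ge 0 (phi x).
  have [-> _|x0] := eqVneq x 0; first by rewrite rmorph0; exact: order_ge0.
  case=> [/eqP|]; first by rewrite (negPf x0).
  by move/order_geE; apply; rewrite fmorph_eq0.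
have [/vO O1 /vO/order_ge0P[g e]] := sO p ps.
rewrite rmorphM /= -mulrA phi_d e lder_tofrac -[0]addr0; apply: order_geM => //.
exact: order_ge_tofrac.
Qed.

End Valuation.

Section Signs.

Variables (W Y1 Y2 : L).
Hypothesis W_inj : injective (pev (@lC k) W).
Hypotheses (Y1E : Y1 ^+ 2 = pev (@lC k) W f1) (Y2E : Y2 ^+ 2 = pev (@lC k) W f2).

Lemma sign_embedding (s1 s2 : bool) : exists phi : {rmorphism K -> L},
  [/\ forall c, phi (iota c) = lC c, phi w = W,
      phi y1 = (-1) ^+ s1 * Y1 & phi y2 = (-1) ^+ s2 * Y2].
Proof.
by apply: (bq_lift bq) => //; rewrite exprMn sqrr_sign mul1r.
Qed.

Lemma order_ge_signs (b : int) (x0 x1 x2 x3 : L) :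
  (forall s1 s2 : bool, order_ge b (x0 + (-1) ^+ s1 * x1 + (-1) ^+ s2 * x2
     + (-1) ^+ s1 * (-1) ^+ s2 * x3)) ->
  [/\ order_ge b x0, order_ge b x1, order_ge b x2 & order_ge b x3].
Proof.
move=> h; have [e0 e1 e2 e3] := sign_average x0 x1 x2 x3.
have quarter (x : L) : order_ge b (4 * x) -> order_ge b x.
  have n4 : (4 : k) != 0 by rewrite (_ : 4 = 2 * 2) ?mulf_neq0 // -natrM.
  move=> /(order_geM (order_ge_C 4^-1)); rewrite add0r mulrA.
  have e4 : lC 4 = 4 :> L by exact: (rmorph_nat (@lC k) 4).
  by rewrite -e4 -rmorphM mulVf // rmorph1 mul1r.
split; apply: quarter; rewrite ?e0 ?e1 ?e2 ?e3.
- exact: order_geD (order_geD (h false false) (h false true))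
    (order_geD (h true false) (h true true)).
- exact: order_geB (order_geD (h false false) (h false true))
    (order_geD (h true false) (h true true)).
- exact: order_geB (order_geD (h false false) (h true false))
    (order_geD (h false true) (h true true)).
- exact: order_geB (order_geD (h false false) (h true true))
    (order_geD (h false true) (h true false)).
Qed.

End Signs.

End LocalEmbeddings.

Lemma order_ge_all0 (k : fieldType) (z : laurent k) : (forall b, order_ge b z) -> z = 0.
Proof.
move=> h; apply/eqP; apply: contraT => z0.
by have := order_ge_le (ordP z0) (h (ord z + 1)); lia.
Qed.

Lemma signed_fraction (F : fieldType) (s1 s2 Y1 Y2 E G c Q0 Q1 Q2 Q3 : F) :
  s1^-1 = s1 -> s2^-1 = s2 ->
  (Q0 + Q1 / (s1 * Y1) + Q2 / (s2 * Y2) + Q3 / ((s1 * Y1) * (s2 * Y2) / E)) / G * c =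
  Q0 / G * c + s1 * (Q1 / Y1 / G * c) + s2 * (Q2 / Y2 / G * c)
    + s1 * s2 * (Q3 / (Y1 * Y2 / E) / G * c).
Proof. by move=> e1 e2; rewrite !invfM e1 e2 !invrK; ring. Qed.

Lemma opp_double n : - (n.*2.+1.-1)%:Z = - n%:Z *+ 2.
Proof. by rewrite mulr2n; lia. Qed.

(** * The space of regular differentials of the biquadratic field *)

Section Genus.

Variables (k : closedFieldType) (A B E : {poly k}) (K : fieldType) (iota : {rmorphism k -> K}).
Variables (w y1 y2 : K) (d : K -> K).
Hypothesis bq : biquadratic (E * A) (E * B) iota w y1 y2 d.
Hypothesis two : (2 : k) != 0.
Hypothesis sep : forall c, root (A * B * E) c -> ~~ root (A * B * E)^`() c.
Variables (m1 m2 m3 : nat).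
Hypothesis size1 : size (E * A) = m1.*2.+1.
Hypothesis size2 : size (E * B) = m2.*2.+1.
Hypothesis size3 : size (A * B) = m3.*2.+1.

Local Notation L := (laurent k).
Local Notation ev := (pev iota w).
Local Notation "x %:F" := (FracField.tofrac x).
Local Notation evL := (pev (@lC k)).

Let EA0 : E * A != 0. Proof. by rewrite -size_poly_gt0 size1. Qed.
Let EB0 : E * B != 0. Proof. by rewrite -size_poly_gt0 size2. Qed.
Let E0 : E != 0. Proof. by apply: contraNneq EA0 => ->; rewrite mul0r. Qed.
Let A0 : A != 0. Proof. by apply: contraNneq EA0 => ->; rewrite mulr0. Qed.
Let B0 : B != 0. Proof. by apply: contraNneq EB0 => ->; rewrite mulr0. Qed.

Let ev0 p : p != 0 -> ev p != 0.
Proof. by rewrite -(inj_eq (bq_inj bq)) rmorph0. Qed.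
Let y1_neq0 := y1_neq0 bq EA0.
Let y2_neq0 := y2_neq0 bq EB0.

Definition y3 : K := y1 * y2 / ev E.

Lemma y3E : y3 ^+ 2 = ev (A * B).
Proof.
rewrite /y3 expr_div_n exprMn (bq_y1 bq) (bq_y2 bq) !rmorphM /=.
by have := ev0 E0 => n; field.
Qed.

Lemma simple_factor (p q : {poly k}) c : p * q = A * B * E -> root p c -> ~~ root p^`() c.
Proof.
move=> pq pc; have := @sep c; rewrite -pq rootM pc => /(_ isT).
rewrite derivM /root !hornerE (eqP (pc : p.[c] == 0)) mul0r addr0.
by rewrite mulf_eq0 negb_or => /andP[].
Qed.

Lemma coprime_factor (p q : {poly k}) : p * q = A * B * E -> coprimep p p^`().
Proof.
move=> pq; apply/Pdiv.ClosedField.coprimepP => c; exact: simple_factor pq.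
Qed.

Let fac1 : (E * A) * B = A * B * E. Proof. by ring. Qed.
Let fac2 : (E * B) * A = A * B * E. Proof. by ring. Qed.
Let fac3 : (A * B) * E = A * B * E. Proof. by []. Qed.

(** The basis 1, 1/y1, 1/y2, 1/y3 is chosen because each dw / yi is regular over finite w, so that
    regularity will amount to polynomial coefficients of bounded degree. *)
Lemma decomposition z : exists (g q0 q1 q2 q3 : {poly k}), g != 0 /\
  z = (ev q0 + ev q1 / y1 + ev q2 / y2 + ev q3 / y3) / ev g.
Proof.
have [g [p0 [p1 [p2 [p3 [g0 ->]]]]]] := bq_decomp bq z.
exists g, p0, (p1 * (E * A)), (p2 * (E * B)), (p3 * (E * A * B)); split=> //.
have e3 : y3 = y1 * y2 / ev E by [].
have e : ev (p3 * (E * A * B)) = ev p3 * (y1 ^+ 2 * y2 ^+ 2) / ev E.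
  by rewrite (bq_y1 bq) (bq_y2 bq) !rmorphM /=; have := ev0 E0 => n; field.
rewrite e [ev (p1 * _)]rmorphM [ev (p2 * _)]rmorphM /= -(bq_y1 bq) -(bq_y2 bq) e3.
move: (ev0 g0) (ev0 E0) y1_neq0 y2_neq0 => *.
by field; do ?[apply/and4P; split|apply/and3P; split | apply/andP; split].
Qed.

(** [mu p] is the order of p(W) in x and [delta] that of dW/dx. The parity fields provide square
    roots of (E A)(W) and (E B)(W) in Laurent series; the last field makes the induced valuation
    normalized. *)
Record local_model (W : L) (mu : {poly k} -> int) (delta : int) : Prop := LocalModel {
  lm_order : forall p, p != 0 -> has_order (mu p) (evL W p);
  lm_der : has_order delta (lder W);
  lm_even1 : exists n, mu (E * A) = n + n;
  lm_even2 : exists n, mu (E * B) = n + n;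
  lm_unif : forall phi : {rmorphism K -> L}, (forall c, phi (iota c) = lC c) ->
    phi w = W -> exists u, has_order 1 (phi u) }.

Section LocalModel.

Variables (W : L) (mu : {poly k} -> int) (delta : int).
Hypothesis model : local_model W mu delta.

Lemma model_inj : injective (evL W).
Proof. by apply: has_order_inj => p /(lm_order model); exists (mu p). Qed.

Lemma muM p q : p != 0 -> q != 0 -> mu (p * q) = mu p + mu q.
Proof.
move=> p0 q0; apply: (has_order_uniq (z := evL W (p * q))).
  by apply: (lm_order model); rewrite mulf_neq0.
by rewrite rmorphM; apply: has_orderM; exact: (lm_order model).
Qed.

Lemma model_roots : exists n1 n2 (Y1 Y2 : L),
  [/\ n1 + n1 = mu (E * A), n2 + n2 = mu (E * B), has_order n1 Y1, has_order n2 Y2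
    & Y1 ^+ 2 = evL W (E * A) /\ Y2 ^+ 2 = evL W (E * B)].
Proof.
have [n1 e1] := lm_even1 model; have [n2 e2] := lm_even2 model.
have := lm_order model EA0; rewrite e1 => /(laurent_sqrt two)[Y1 Y1E o1].
have := lm_order model EB0; rewrite e2 => /(laurent_sqrt two)[Y2 Y2E o2].
by exists n1, n2, Y1, Y2.
Qed.

(* Averaging over the four embeddings (y1, y2) |-> (+-Y1, +-Y2) isolates each term. *)
Lemma order_ge_terms (Y1 Y2 : L) (b : int) (c : L) (z : K) (g q0 q1 q2 q3 : {poly k}) :
  Y1 ^+ 2 = evL W (E * A) -> Y2 ^+ 2 = evL W (E * B) ->
  z = (ev q0 + ev q1 / y1 + ev q2 / y2 + ev q3 / y3) / ev g ->
  (forall phi : {rmorphism K -> L}, (forall c, phi (iota c) = lC c) ->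
     phi w = W -> order_ge b (phi z * c)) ->
  [/\ order_ge b (evL W q0 / evL W g * c), order_ge b (evL W q1 / Y1 / evL W g * c),
      order_ge b (evL W q2 / Y2 / evL W g * c)
    & order_ge b (evL W q3 / (Y1 * Y2 / evL W E) / evL W g * c)].
Proof.
move=> Y1E Y2E zE h; apply: (order_ge_signs two) => s1 s2.
have [phi [phiC phiw phi1 phi2]] := sign_embedding bq model_inj Y1E Y2E s1 s2.
have phiev p : phi (ev p) = evL W p by rewrite (rmorph_pev phiC) phiw.
have := h phi phiC phiw; rewrite zE /y3.
rewrite !(rmorphM, rmorphD, fmorphV) /= !phiev phi1 phi2.
by rewrite signed_fraction ?invr_sign.
Qed.

(** Once the terms are separated, each of them has nonnegative order. The inequalities are doubled
    because [mu] gives the order of yi^2, twice that of yi. *)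
Lemma regular_term_bounds (z : K) (g q0 q1 q2 q3 : {poly k}) : g != 0 ->
  z = (ev q0 + ev q1 / y1 + ev q2 / y2 + ev q3 / y3) / ev g ->
  @is_regular_form k K iota K^o d z ->
  [/\ q0 != 0 -> 0 <= mu q0 - mu g + delta,
      q1 != 0 -> mu (E * A) <= (mu q1 - mu g + delta) *+ 2,
      q2 != 0 -> mu (E * B) <= (mu q2 - mu g + delta) *+ 2
    & q3 != 0 -> mu (A * B) <= (mu q3 - mu g + delta) *+ 2].
Proof.
move=> g0 zE reg; have h (phi : {rmorphism K -> L}) : (forall c, phi (iota c) = lC c) ->
    phi w = W -> order_ge 0 (phi z * lder W).
  move=> phiC phiw; have [u ou] := lm_unif model phiC phiw.
  by rewrite -phiw; exact: (regular_order bq two EA0 EB0 phiC ou reg).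
have [n1 [n2 [Y1 [Y2 [e1 e2 o1 o2 [Y1E Y2E]]]]]] := model_roots.
have [h0 h1 h2 h3] := order_ge_terms Y1E Y2E zE h.
have oP q : q != 0 -> has_order (mu q) (evL W q) by exact: (lm_order model).
have oG := has_orderV (oP g g0); have oD := lm_der model.
have e3 : (n1 + n2 - mu E) *+ 2 = mu (A * B).
  by rewrite muM //; have := muM E0 A0; have := muM E0 B0; clear -e1 e2; lia.
have o3 := has_orderM (has_orderM o1 o2) (has_orderV (oP E E0)).
split=> /oP oq.
- have := order_ge_le (has_orderM (has_orderM oq oG) oD) h0.
  by clear -e1 e2 e3; lia.
- have := order_ge_le (has_orderM (has_orderM (has_orderM oq (has_orderV o1)) oG) oD) h1.
  by clear -e1 e2 e3; lia.
- have := order_ge_le (has_orderM (has_orderM (has_orderM oq (has_orderV o2)) oG) oD) h2.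
  by clear -e1 e2 e3; lia.
- have := order_ge_le (has_orderM (has_orderM (has_orderM oq (has_orderV o3)) oG) oD) h3.
  by clear -e1 e2 e3; lia.
Qed.

(** Zero has order at least b for every b, hence so has each separated term, which must therefore
    vanish. *)
Lemma terms_eq0 (g q0 q1 q2 q3 : {poly k}) : g != 0 ->
  (ev q0 + ev q1 / y1 + ev q2 / y2 + ev q3 / y3) / ev g = 0 ->
  [/\ q0 = 0, q1 = 0, q2 = 0 & q3 = 0].
Proof.
move=> g0 /esym zE.
have hb b : forall phi : {rmorphism K -> L}, (forall c, phi (iota c) = lC c) ->
    phi w = W -> order_ge b (phi 0 * 1).
  by move=> phi _ _; rewrite rmorph0 mul0r; exact: order_ge0.
have [n1 [n2 [Y1 [Y2 [_ _ o1 o2 [Y1E Y2E]]]]]] := model_roots.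
have evL0 q : q != 0 -> evL W q != 0 by rewrite -(inj_eq model_inj) rmorph0.
have ev_eq0 q x : x != 0 -> evL W q * x = 0 -> q = 0.
  move=> x0 /eqP; rewrite mulf_eq0 (negPf x0) orbF -(rmorph0 (evL W)).
  by rewrite (inj_eq model_inj) => /eqP.
have hz b := order_ge_terms Y1E Y2E zE (hb b).
have [Y10 Y20] := (has_order_neq0 o1, has_order_neq0 o2).
have [EW0 gW0] := (evL0 E E0, evL0 g g0).
split.
- apply: (ev_eq0 _ (evL W g)^-1); first exact: invr_neq0.
  by apply: order_ge_all0 => b; have [+ _ _ _] := hz b; rewrite mulr1.
- apply: (ev_eq0 _ (Y1^-1 / evL W g)); first exact: mulf_neq0 (invr_neq0 Y10) (invr_neq0 gW0).
  by apply: order_ge_all0 => b; have [_ + _ _] := hz b; rewrite mulr1 mulrA.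
- apply: (ev_eq0 _ (Y2^-1 / evL W g)); first exact: mulf_neq0 (invr_neq0 Y20) (invr_neq0 gW0).
  by apply: order_ge_all0 => b; have [_ _ + _] := hz b; rewrite mulr1 mulrA.
- apply: (ev_eq0 _ ((Y1 * Y2 / evL W E)^-1 / evL W g)).
    exact: mulf_neq0 (invr_neq0 (mulf_neq0 (mulf_neq0 Y10 Y20) (invr_neq0 EW0)))
      (invr_neq0 gW0).
  by apply: order_ge_all0 => b; have [_ _ _ +] := hz b; rewrite mulr1 mulrA.
Qed.

End LocalModel.

Lemma has_order_sqrt (x : L) n : has_order (n + n) (x ^+ 2) -> has_order n x.
Proof.
move=> h; have x0 : x != 0.
  by have := has_order_neq0 h; rewrite expf_eq0.
have o := ordP x0; have := has_order_uniq h (has_orderX 2 o).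
by move=> e; have <- : ord x = n by clear -e; lia.
Qed.

Lemma finite_model c : exists (W : L) (e : nat),
  [/\ (0 < e)%N, W = (poly_ps (c%:P + 'X^e))%:F
    & local_model W (fun p => (e * mup c p)%N%:Z) (e%:Z - 1)].
Proof.
(* The ramification index: as A B E has simple roots, doubling orders at its roots makes those of E
   A and E B even. *)
pose e : nat := if root (A * B * E) c then 2 else 1.
have e0 : (0 < e)%N by rewrite /e; case: ifP.
exists (poly_ps (c%:P + 'X^e))%:F, e; split=> //.
set W := _%:F.
have We : W = lC c + lX k ^+ e.
  by rewrite /W rmorphD rmorphXn tofracD tofracXn.
have ct_W : ct (poly_ps (c%:P + 'X^e)) = c.
  by rewrite /ct /poly_ps coefD coefC coefXn -[e]prednK //= addr0.
have ord_p p : p != 0 -> has_order (e * mup c p)%N%:Z (evL W p).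
  apply: (@has_order_pev _ W (poly_ps (c%:P + 'X^e)) c e p) => //.
  rewrite We addrC addKr -[e%:Z]natz; exact: has_orderX (has_order_X k).
have even p q : p != 0 -> p * q = A * B * E ->
    exists n, (e * mup c p)%N%:Z = n + n /\ (root p c -> n = 1).
  move=> p0 pq; have [pc|pc] := boolP (root p c).
    have ec : e = 2 by rewrite /e -pq rootM pc.
    by exists 1; rewrite ec (mup_simple_root pc (simple_factor pq pc)).
  by exists 0; rewrite mupNroot // muln0.
split=> //.
- rewrite /W lder_tofrac psder_poly derivD derivC add0r derivXn.
  have -> : poly_ps ('X^(e.-1) *+ e) = psX k ^+ e.-1 * psC (e%:R : k).
    by rewrite -mulr_natr rmorphM rmorphXn -polyC_natr.
  rewrite tofracM tofracXn -[_ - 1]addr0; apply: has_orderM; last first.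
    apply: has_order_unit; rewrite ct_C /e; case: ifP => _ //; exact: oner_neq0.
  have -> : e%:Z - 1 = 1 *+ e.-1 by rewrite -{1}(prednK e0) -natz; clear; lia.
  exact: has_orderX (has_order_X k).
- by have [n [n_e _]] := even _ _ EA0 fac1; exists n.
- by have [n [n_e _]] := even _ _ EB0 fac2; exists n.
move=> phi phiC phiw; have phiev p : phi (ev p) = evL W p by rewrite (rmorph_pev phiC) phiw.
(* At a root of A B E, y1^2 or y2^2 has order 2 in x, so y1 or y2 is a uniformizer; elsewhere w - c
   is one. *)
have unif p q y : p != 0 -> p * q = A * B * E -> y ^+ 2 = ev p -> root p c ->
    has_order 1 (phi y).
  move=> p0 pq yE pc; apply: has_order_sqrt; rewrite -rmorphXn yE phiev.
  have [n [n_e n1]] := even p q p0 pq; rewrite (n1 pc) in n_e.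
  by rewrite -n_e; exact: ord_p.
have [rc|rc] := boolP (root (A * B * E) c); last first.
  exists (w - iota c); rewrite rmorphB phiC phiw We addrC addKr /e (negPf rc).
  exact: has_order_X.
have [r1|r1] := boolP (root (E * A) c); first by exists y1; apply: unif EA0 fac1 (bq_y1 bq) r1.
exists y2; apply: unif EB0 fac2 (bq_y2 bq) _.
by move: rc r1; rewrite !rootM; do ?case: root.
Qed.

(** Even degrees make w = oo unramified, so x = 1 / w is a uniformizer; -2 is the order of dw = -
    x^-2 dx. *)
Lemma infinite_model : local_model (lX k)^-1 (fun p => - (size p).-1%:Z) (-2).
Proof.
split.
- exact: has_order_pev_inv.
- have [lD lM] := lder_leibniz k.
  have derL : @is_derivation k L (@lC k) L^o (@lder k).
    by split=> [x y|x y|c]; [exact: lD|exact: lM|exact: lder_C].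
  have -> : lder (lX k)^-1 = - ((lX k)^-1 * (lX k)^-1).
    rewrite (derivationV derL) ?lX_neq0 // {2}/lX lder_tofrac psder_poly derivX.
    by rewrite !rmorph1 expr2 invfM; congr (- _); exact: mulr1.
  apply: has_orderN; have o := has_orderV (has_order_X k).
  exact: (has_orderM o o).
- by exists (- m1%:Z); rewrite size1; clear; lia.
- by exists (- m2%:Z); rewrite size2; clear; lia.
move=> phi _ phiw; exists w^-1; rewrite fmorphV phiw invrK; exact: has_order_X.
Qed.

(** A pole of q / g at c would make the order at most -e + (e - 1) < 0, so g divides q. At infinity,
    -n <= -deg h - 2 bounds the degree of the quotient h by n - 2. *)
Lemma pole_free (q g : {poly k}) n : g != 0 ->
  (forall c, exists2 e : nat, (0 < e)%N & q != 0 ->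
    0 <= ((e * mup c q)%N%:Z - (e * mup c g)%N%:Z + (e%:Z - 1)) *+ 2) ->
  (q != 0 -> - n%:Z *+ 2 <= (- (size q).-1%:Z - - (size g).-1%:Z - 2) *+ 2) ->
  exists2 h : {poly k}, q = h * g & (size h <= n.-1)%N.
Proof.
move=> g0 fin inf; have [->|q0] := eqVneq q 0; first by exists 0; rewrite ?mul0r ?size_poly0.
have /dvdpP[h qE] : g %| q.
  apply: dvdp_mup => // c; have [e e0 /(_ q0)] := fin c.
  by move: (mup c g) (mup c q) => a b; rewrite mulr2n; clear -e0; nia.
exists h => //; have h0 : h != 0 by apply: contraNneq q0 => h0; rewrite qE h0 mul0r.
have := inf q0; rewrite qE size_mul //.
move: h0 g0; rewrite -!size_poly_gt0 !mulr2n.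
by move: (size h) (size g) => a b; clear; lia.
Qed.

Lemma regular_shape z : @is_regular_form k K iota K^o d z ->
  exists h1 h2 h3 : {poly k},
    [/\ (size h1 <= m1.-1)%N, (size h2 <= m2.-1)%N, (size h3 <= m3.-1)%N
      & z = ev h1 / y1 + ev h2 / y2 + ev h3 / y3].
Proof.
move=> reg; have [g [q0 [q1 [q2 [q3 [g0 zE]]]]]] := decomposition z.
have [b0 b1 b2 b3] := regular_term_bounds infinite_model g0 zE reg.
have fin c : exists2 e : nat, (0 < e)%N &
    let x q := ((e * mup c q)%N%:Z - (e * mup c g)%N%:Z + (e%:Z - 1)) *+ 2 in
    [/\ q0 != 0 -> 0 <= x q0, q1 != 0 -> 0 <= x q1, q2 != 0 -> 0 <= x q2 & q3 != 0 -> 0 <= x q3].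
  have [W [e [e0 _ lm]]] := finite_model c; exists e => //=.
  have [c0 c1 c2 c3] := regular_term_bounds lm g0 zE reg.
  split=> [/c0 h|/c1|/c2|/c3]; first exact: mulrn_wge0.
  - exact: le_trans.
  - exact: le_trans.
  - exact: le_trans.
(* The case n = 0: the part of the differential coming from k(w) is regular on the projective line,
   hence zero. *)
have [h0 q0E s0] : exists2 h : {poly k}, q0 = h * g & (size h <= 0.-1)%N.
  apply: (@pole_free _ _ 0) => // [c|/b0 h]; last by rewrite oppr0 mul0rn; exact: mulrn_wge0.
  by have [e e0 [? _ _ _]] := fin c; exists e.
have [h1 q1E s1] : exists2 h : {poly k}, q1 = h * g & (size h <= m1.-1)%N.
  apply: (@pole_free _ _ m1) => // [c|/b1]; last by rewrite size1 opp_double.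
  by have [e e0 [_ ? _ _]] := fin c; exists e.
have [h2 q2E s2] : exists2 h : {poly k}, q2 = h * g & (size h <= m2.-1)%N.
  apply: (@pole_free _ _ m2) => // [c|/b2]; last by rewrite size2 opp_double.
  by have [e e0 [_ _ ? _]] := fin c; exists e.
have [h3 q3E s3] : exists2 h : {poly k}, q3 = h * g & (size h <= m3.-1)%N.
  apply: (@pole_free _ _ m3) => // [c|/b3]; last by rewrite size3 opp_double.
  by have [e e0 [_ _ _ ?]] := fin c; exists e.
exists h1, h2, h3; split=> //.
have h00 : h0 = 0 by apply/eqP; rewrite -size_poly_eq0 -leqn0.
rewrite zE q0E q1E q2E q3E h00 mul0r rmorph0 add0r !rmorphM /=.
rewrite mulrAC [ev h2 * _ / _]mulrAC [ev h3 * _ / _]mulrAC -!mulrDl mulfK //.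
exact: ev0.
Qed.

Lemma basis_sum n (v : 'rV[k]_n) (y : K) :
  \sum_i iota (v 0 i) * (w ^+ i / y) = ev (rVpoly v) / y.
Proof.
rewrite (pevE _ _ (size_poly _ _)) mulr_suml; apply: eq_bigr => i _.
by rewrite coef_rVpoly_ord mulrA.
Qed.

Lemma has_dim_regular :
  has_dim iota (@is_regular_form k K iota K^o d) (m1.-1 + m2.-1 + m3.-1).
Proof.
pose e (i : 'I_(m1.-1 + m2.-1 + m3.-1)) : K :=
  match split i with
  | inl j => match split j with inl l => w ^+ l / y1 | inr l => w ^+ l / y2 end
  | inr l => w ^+ l / y3
  end.
have sumE (c : 'rV[k]_(m1.-1 + m2.-1 + m3.-1)) :
    \sum_i iota (c 0 i) *: (e i : K^o) = ev (rVpoly (lsubmx (lsubmx c))) / y1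
      + ev (rVpoly (rsubmx (lsubmx c))) / y2 + ev (rVpoly (rsubmx c)) / y3.
  rewrite -!basis_sum big_split_ord big_split_ord /=.
  congr (_ + _ + _); apply: eq_bigr => i _; rewrite /e !mxE.
  - by rewrite (unsplitK (inl (lshift _ i))) (unsplitK (inl i)).
  - by rewrite (unsplitK (inl (rshift _ i))) (unsplitK (inr i)).
  - by rewrite (unsplitK (inr i)).
exists e; split=> [i|z /regular_shape[h1 [h2 [h3 [s1 s2 s3 zE]]]]].
  rewrite /e; case: (split i) => [j|l]; first case: (split j) => l.
  - by apply: (regular_basis bq (bq_y1 bq) (coprime_factor fac1) size1).
  - by apply: (regular_basis bq (bq_y2 bq) (coprime_factor fac2) size2).
  - by apply: (regular_basis bq y3E (coprime_factor fac3) size3).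
exists (row_mx (row_mx (poly_rV h1) (poly_rV h2)) (poly_rV h3)); split=> [|c].
  by rewrite sumE !row_mxKl !row_mxKr !poly_rV_K.
rewrite sumE zE => /eqP; rewrite -subr_eq0 => /eqP e0.
(* Uniqueness of coordinates: the difference of two expansions is a decomposition of 0 with g =
   1. *)
have := @terms_eq0 _ _ _ infinite_model 1 0 (h1 - rVpoly (lsubmx (lsubmx c)))
  (h2 - rVpoly (rsubmx (lsubmx c))) (h3 - rVpoly (rsubmx c)) (oner_neq0 _).
rewrite rmorph0 rmorph1 divr1 add0r !rmorphB /= !mulrBl.
case.
  by rewrite -[RHS]e0; ring.
move=> _ /eqP; rewrite subr_eq0 => /eqP -> /eqP; rewrite subr_eq0 => /eqP -> /eqP.
by rewrite subr_eq0 => /eqP ->; rewrite !rVpolyK !hsubmxK.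
Qed.

End Genus.

(** * The curve *)

Lemma mmap_homog (k R : comNzRingType) n (f : {rmorphism k -> R}) (h : 'I_n -> R) (tau : R)
    d (p : {mpoly k[n]}) : p \is d.-homog ->
  mmap f (fun i => h i * tau) p = tau ^+ d * mmap f h p.
Proof.
move=> /dhomogP hp; rewrite /mmap big_distrr /=; apply: eq_big_seq => m /hp md.
have {md}<- : mdeg m = d by [].
rewrite mulrCA; congr (_ * _); rewrite /mmap1 mdegE expr_sum.
by rewrite -big_split /=; apply: eq_bigr => i _; rewrite exprMn mulrC.
Qed.

Lemma C242E (a : algC) (x : 'I_5 -> algC) :
  let q := x (inord 0) in let s := x (inord 1) in let t := x (inord 2) in
  let u := x (inord 3) in let z := x (inord 4) in
  C242 a x <-> (exists i, x i != 0) /\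
    [/\ s ^+ 2 = t ^+ 2 + t * z - a * z ^+ 2, u ^+ 2 = t ^+ 2 - t * z - a * z ^+ 2
      & q ^+ 2 = t ^+ 2 + s * z - a * z ^+ 2].
Proof.
move=> q s t u z; rewrite /C242 /proj_zeros; split=> -[nz h]; split=> //.
  split.
  - have := h _ (mem_head _ _).
    rewrite !(mevalB, mevalD, mevalN, mevalZ, mevalM, mevalXU, rmorphXn) /= ?mevalXU.
    rewrite -/q -/s -/t -/u -/z => e.
    by apply/eqP; rewrite -subr_eq0 -e; apply/eqP; ring.
  - have := h (a *: 'X_(inord 4) ^+ 2 - 'X_(inord 2) ^+ 2
      - (- ('X_(inord 2) * 'X_(inord 4)) - 'X_(inord 3) ^+ 2)).
    rewrite !inE eqxx orbT => /(_ isT).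
    rewrite !(mevalB, mevalD, mevalN, mevalZ, mevalM, mevalXU, rmorphXn) /= ?mevalXU.
    rewrite -/q -/s -/t -/u -/z => e.
    by apply/eqP; rewrite -subr_eq0 -e; apply/eqP; ring.
  - have := h (a *: 'X_(inord 4) ^+ 2 - 'X_(inord 2) ^+ 2
      - ('X_(inord 1) * 'X_(inord 4) - 'X_(inord 0) ^+ 2)).
    rewrite !inE eqxx !orbT => /(_ isT).
    rewrite !(mevalB, mevalD, mevalN, mevalZ, mevalM, mevalXU, rmorphXn) /= ?mevalXU.
    rewrite -/q -/s -/t -/u -/z => e.
    by apply/eqP; rewrite -subr_eq0 -e; apply/eqP; ring.
case: h => e1 e2 e3 f; rewrite !inE => /or3P[] /eqP ->;
  rewrite !(mevalB, mevalD, mevalN, mevalZ, mevalM, mevalXU, rmorphXn) /= ?mevalXU;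
  rewrite -/q -/s -/t -/u -/z -!expr2 ?e1 ?e2 ?e3; ring.
Qed.

(** A negative order of v would double in v^2, which is a power series. *)
Lemma sqrt_tofrac (k : fieldType) (v : laurent k) (f : pseries k) :
  v ^+ 2 = FracField.tofrac f -> exists V : pseries k,
    v = FracField.tofrac V /\ ct V ^+ 2 = ct f.
Proof.
move=> e; have [V vE] : exists V : pseries k, v = FracField.tofrac V.
  apply: order_ge0P; have [->|v0] := eqVneq v 0; first exact: order_ge0.
  apply/order_geE => //; have := order_ge_tofrac f; rewrite -e.
  by move/(order_ge_le (has_orderX 2 (ordP v0))); lia.
exists V; split=> //; rewrite -rmorphXn; congr ct; apply/eqP.
by rewrite -tofrac_eq tofracXn -vE e.
Qed.

Definition coords (R : nzRingType) (q s t u z : R) : 'I_5 -> R :=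
  fun i => [:: q; s; t; u; z]`_i.

Lemma coordsE (R : nzRingType) (q s t u z : R) :
  [/\ coords q s t u z (inord 0) = q, coords q s t u z (inord 1) = s,
      coords q s t u z (inord 2) = t, coords q s t u z (inord 3) = u
    & coords q s t u z (inord 4) = z].
Proof. by rewrite /coords !inordK. Qed.

Lemma coords_ind (R S : nzRingType) (P : R -> S -> Prop) (q s t u z : R) (q' s' t' u' z' : S) :
  P q q' -> P s s' -> P t t' -> P u u' -> P z z' ->
  forall i, P (coords q s t u z i) (coords q' s' t' u' z' i).
Proof. by move=> ? ? ? ? ? [[|[|[|[|[|//]]]]] /= ?]. Qed.

Lemma coords_id (R : nzRingType) (x : 'I_5 -> R) i :
  coords (x (inord 0)) (x (inord 1)) (x (inord 2)) (x (inord 3)) (x (inord 4)) i = x i.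
Proof.
by case: i => [[|[|[|[|[|//]]]]] /= h]; rewrite /coords /=; congr x; apply: val_inj;
  rewrite /= inordK.
Qed.

Section Curve.

Variable a : algC.

(* (s : t : z) = (polyS(w) : polyT(w) : polyZ(w)) parametrizes the conic, and
   u^2 = polyU(w), q^2 = polyQ(w) there. *)
Definition polyS : {poly algC} := - 'X^2 + 'X + a%:P.
Definition polyT : {poly algC} := 'X^2 + a%:P.
Definition polyZ : {poly algC} := 1 - 2 *: 'X.
Definition polyU : {poly algC} :=
  'X^4 + 2 *: 'X^3 - (1 + 2 * a) *: 'X^2 + (6 * a) *: 'X + (a ^+ 2 - 2 * a)%:P.
Definition polyQ : {poly algC} :=
  'X^4 + 2 *: 'X^3 - (3 + 2 * a) *: 'X^2 + (1 + 2 * a) *: 'X + (a ^+ 2)%:P.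

Lemma polySE : polyS ^+ 2 = polyT ^+ 2 + polyT * polyZ - a *: polyZ ^+ 2.
Proof. by rewrite /polyS /polyT /polyZ -!mul_polyC; ring. Qed.
Lemma polyUE : polyU = polyT ^+ 2 - polyT * polyZ - a *: polyZ ^+ 2.
Proof. by rewrite /polyU /polyT /polyZ -!mul_polyC; ring. Qed.
Lemma polyQE : polyQ = polyT ^+ 2 + polyS * polyZ - a *: polyZ ^+ 2.
Proof. by rewrite /polyQ /polyS /polyT /polyZ -!mul_polyC; ring. Qed.

Lemma curve_at c :
  [/\ polyS.[c] ^+ 2 = polyT.[c] ^+ 2 + polyT.[c] * polyZ.[c] - a * polyZ.[c] ^+ 2,
    polyU.[c] = polyT.[c] ^+ 2 - polyT.[c] * polyZ.[c] - a * polyZ.[c] ^+ 2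
  & polyQ.[c] = polyT.[c] ^+ 2 + polyS.[c] * polyZ.[c] - a * polyZ.[c] ^+ 2].
Proof.
rewrite -horner_exp polySE polyUE polyQE.
by rewrite !(hornerD, hornerN, hornerM, hornerZ, horner_exp).
Qed.

Lemma size_polyS : (size polyS <= 3)%N.
Proof. by apply/leq_sizeP => -[|[|[|j]]] // _; rewrite /polyS !coefE /=; ring. Qed.
Lemma size_polyT : (size polyT <= 3)%N.
Proof. by apply/leq_sizeP => -[|[|[|j]]] // _; rewrite /polyT !coefE /=; ring. Qed.
Lemma size_polyZ : (size polyZ <= 3)%N.
Proof. by apply/leq_sizeP => -[|[|[|j]]] // _; rewrite /polyZ !coefE /=; ring. Qed.
Lemma size_polyU : (size polyU <= 5)%N.
Proof. by apply/leq_sizeP => -[|[|[|[|[|j]]]]] // _; rewrite /polyU !coefE /=; ring. Qed.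
Lemma size_polyQ : (size polyQ <= 5)%N.
Proof. by apply/leq_sizeP => -[|[|[|[|[|j]]]]] // _; rewrite /polyQ !coefE /=; ring. Qed.
Lemma coef_polyU4 : polyU`_4 = 1.
Proof. by rewrite /polyU !coefE /=; ring. Qed.
Lemma coef_polyQ4 : polyQ`_4 = 1.
Proof. by rewrite /polyQ !coefE /=; ring. Qed.

Variables (A B E h1 h2 : {poly algC}) (m1 m2 m3 : nat).
Variables (K : fieldType) (iota : {rmorphism algC -> K}) (w y1 y2 : K) (d : K -> K).
Hypothesis bq : biquadratic (E * A) (E * B) iota w y1 y2 d.
Hypothesis sep : forall c, root (A * B * E) c -> ~~ root (A * B * E)^`() c.
Hypothesis size1 : size (E * A) = m1.*2.+1.
Hypothesis size2 : size (E * B) = m2.*2.+1.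
Hypothesis size3 : size (A * B) = m3.*2.+1.
Hypothesis UE : polyU = h1 ^+ 2 * (E * A).
Hypothesis QE : polyQ = h2 ^+ 2 * (E * B).
Hypothesis conic_smooth : 1 + 4 * a != 0.

Let two : (2 : algC) != 0. Proof. by rewrite pnatr_eq0. Qed.
Local Notation L := (laurent algC).
Local Notation "x %:F" := (FracField.tofrac x).
Local Notation ev := (pev iota w).
Local Notation evL := (pev (@lC algC)).
Local Notation evP := (pev (@psC algC)).

Let uK := ev h1 * y1.
Let qK := ev h2 * y2.
Definition generic_point : 'I_5 -> K := coords qK (ev polyS) (ev polyT) uK (ev polyZ).
Local Notation xi := generic_point.

Let uKE : uK ^+ 2 = ev polyU.
Proof. by rewrite /uK exprMn (bq_y1 bq) UE [RHS]rmorphM /= rmorphXn. Qed.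
Let qKE : qK ^+ 2 = ev polyQ.
Proof. by rewrite /qK exprMn (bq_y2 bq) QE [RHS]rmorphM /= rmorphXn. Qed.

(** Scaling the generic point by [tau] multiplies a form of degree n by tau^n. Once the coordinates
    are power series, taking constant terms is a ring morphism to k and turns p(X) into p at the
    point x. *)
Lemma specialize (phi : {rmorphism K -> L}) (tau : L) (X : 'I_5 -> pseries algC)
    (x : 'I_5 -> algC) n (p : {mpoly algC[5]}) :
  (forall c, phi (iota c) = lC c) -> (forall i, phi (xi i) * tau = (X i)%:F) ->
  (forall i, ct (X i) = x i) -> p \is n.-homog ->
  tau ^+ n * phi (mmap iota xi p) = (mmap (@psC algC) X p)%:F /\
  ct (mmap (@psC algC) X p) = p.@[x].
Proof.
move=> phiC phixi Xx hp; split; last first.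
  apply: (@rmorph_mmap _ _ _ _ (@psC algC) idfun (@ct algC)) => // c; exact: ct_C.
rewrite (@rmorph_mmap _ _ _ _ _ (@lC algC) phi _ (fun i => phi (xi i))) // -mmap_homog //.
rewrite (@rmorph_mmap _ _ _ _ _ (@lC algC) (@FracField.tofrac _) _
  (fun i => phi (xi i) * tau)) //.
Qed.

(** The coordinates s, t, z of a point fix u and q only up to sign, and the four embeddings realize
    all choices of signs. *)
Lemma lift_point (W tau : L) mu delta (S T Z FU FQ : pseries algC) (q u : algC) :
  local_model A B E iota w W mu delta ->
  evL W polyS * tau = S%:F -> evL W polyT * tau = T%:F -> evL W polyZ * tau = Z%:F ->
  evL W polyU * tau ^+ 2 = FU%:F -> evL W polyQ * tau ^+ 2 = FQ%:F ->
  ct FU = u ^+ 2 -> ct FQ = q ^+ 2 ->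
  exists (phi : {rmorphism K -> L}) (X : 'I_5 -> pseries algC),
    [/\ forall c, phi (iota c) = lC c, forall i, phi (xi i) * tau = (X i)%:F
      & forall i, ct (X i) = coords q (ct S) (ct T) u (ct Z) i].
Proof.
move=> lm eS eT eZ eU eQ cU cQ.
have [n1 [n2 [Y1 [Y2 [_ _ _ _ [Y1E Y2E]]]]]] := model_roots two size1 size2 lm.
have choose (h : {poly algC}) (Y : L) (F f : {poly algC}) (G : pseries algC) r :
    Y ^+ 2 = evL W f -> F = h ^+ 2 * f -> evL W F * tau ^+ 2 = G%:F -> ct G = r ^+ 2 ->
    exists (s : bool) (V : pseries algC),
      evL W h * ((-1) ^+ s * Y) * tau = V%:F /\ ct V = r.
  move=> YE FE GE Gr.
  have : (evL W h * Y * tau) ^+ 2 = G%:F.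
    by rewrite -GE FE !exprMn YE rmorphM rmorphXn.
  move=> /sqrt_tofrac[V [VE cV]]; have /eqP := etrans cV Gr.
  rewrite eqf_sqr => /orP[] /eqP cVr.
    by exists false, V; rewrite expr0 mul1r.
  exists true, (- V); rewrite expr1 mulN1r mulrN mulNr tofracN VE; split=> //.
  by rewrite rmorphN /= cVr opprK.
have [s1 [V1 [V1E cV1]]] := choose _ _ _ _ _ _ Y1E UE eU cU.
have [s2 [V2 [V2E cV2]]] := choose _ _ _ _ _ _ Y2E QE eQ cQ.
have [phi [phiC phiw phi1 phi2]] := sign_embedding bq (model_inj lm) Y1E Y2E s1 s2.
have phiev p : phi (ev p) = evL W p by rewrite (rmorph_pev phiC) phiw.
exists phi, (coords V2 S T V1 Z); split=> // i; rewrite /xi.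
  apply: (coords_ind (P := fun b (c : pseries algC) => phi b * tau = c%:F));
    rewrite ?phiev // rmorphM /= phiev ?phi1 ?phi2 //.
by apply: (coords_ind (P := fun (b : pseries algC) c => ct b = c)).
Qed.

(** For z nonzero, w = (s - t) / z. On z = 0 the conic has s = t, which is w = 1/2, and s = -t,
    which is w = oo. At w = 1/2 both S and T equal (1 + 4 a) / 4, hence the condition of
    smoothness. *)
Lemma point_param (x : 'I_5 -> algC) : C242 a x ->
  let s := x (inord 1) in let t := x (inord 2) in let z := x (inord 4) in
  exists rho, (exists c, [/\ s = rho * polyS.[c], t = rho * polyT.[c] & z = rho * polyZ.[c]])
    \/ [/\ s = - rho, t = rho & z = 0].
Proof.
move=> /C242E[_ [e1 _ _]] s t z; move: e1; rewrite -/s -/t -/z => e1.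
have ev c : [/\ polyS.[c] = a + c - c ^+ 2, polyT.[c] = c ^+ 2 + a & polyZ.[c] = 1 - 2 * c].
  by rewrite /polyS /polyT /polyZ !hornerE; split; ring.
have [z0|z0] := eqVneq z 0.
  move: e1; rewrite z0 expr0n mulr0 mulr0 subr0 addr0 => /eqP.
  rewrite eqf_sqr => /orP[] /eqP st; last by exists t; right.
  have n4 : (4 : algC) != 0 by rewrite pnatr_eq0.
  exists (t / ((1 + 4 * a) / 4)); left; exists (1 / 2); have [-> -> ->] := ev (1 / 2).
  by rewrite st; split; field.
pose c := (s - t) / z.
have sE : s = t + c * z by rewrite /c; field.
have tE : t * (1 - 2 * c) = z * (c ^+ 2 + a).
  apply: (mulIf z0); apply/eqP; rewrite -subr_eq0; apply/eqP.
  transitivity ((t ^+ 2 + t * z - a * z ^+ 2) - s ^+ 2); first by rewrite sE; ring.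
  by rewrite e1 subrr.
have c2 : 1 - 2 * c != 0.
  apply/eqP => c2; move: tE; rewrite c2 mulr0 => /esym/eqP.
  rewrite mulf_eq0 (negPf z0) /= => /eqP ca.
  case/eqP: conic_smooth.
  have -> : 1 + 4 * a = 4 * (c ^+ 2 + a) + (1 - 2 * c) * (1 + 2 * c) by ring.
  by rewrite ca c2 mulr0 mul0r addr0.
exists (z / (1 - 2 * c)); left; exists c; have [-> -> ->] := ev c.
have tE' : t = z * (c ^+ 2 + a) / (1 - 2 * c) by rewrite -tE mulfK.
by rewrite sE tE'; split; field.
Qed.

(** Every point of the curve is the constant term of a rescaled Laurent expansion of the generic
    point, so a form killed by the latter vanishes there. *)
Lemma generic_to_point n (p : {mpoly algC[5]}) : p \is n.-homog ->
  mmap iota xi p = 0 -> vanishes_on (C242 a) p.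
Proof.
move=> hp p0 x Xx; have [_ [e1 e2 e3]] := (C242E a x).1 Xx.
suff [tau [phi [X [phiC phiX ctX]]]] : exists tau (phi : {rmorphism K -> L})
    (X : 'I_5 -> pseries algC), [/\ forall c, phi (iota c) = lC c,
      forall i, phi (xi i) * tau = (X i)%:F & forall i, ct (X i) = x i].
  have [] := specialize phiC phiX ctX hp; rewrite p0 rmorph0 mulr0 => /esym/eqP.
  by rewrite tofrac_eq0 => /eqP -> <-; rewrite rmorph0.
have [rho [[c [sE tE zE]]|[sE tE zE]]] := point_param Xx.
  have [W [e [e0 -> lm]]] := finite_model bq two sep size1 size2 c.
  set f := poly_ps _ in lm.
  have fc : ct f = c by rewrite /ct /f /poly_ps coefD coefC coefXn -[e]prednK //= addr0.
  have evf p' : evL f%:F p' * lC rho = (evP f p' * psC rho)%:F.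
    by rewrite pev_tofrac tofracM.
  have evf2 p' : evL f%:F p' * lC rho ^+ 2 = (evP f p' * psC rho ^+ 2)%:F.
    by rewrite pev_tofrac tofracM tofracXn.
  have ctf p' : ct (evP f p' * psC rho) = rho * p'.[c].
    by rewrite rmorphM /= ct_pev ct_C fc mulrC.
  have ctf2 p' : ct (evP f p' * psC rho ^+ 2) = rho ^+ 2 * p'.[c].
    by rewrite rmorphM rmorphXn /= ct_pev ct_C fc mulrC.
  have cU : ct (evP f polyU * psC rho ^+ 2) = x (inord 3) ^+ 2.
    by rewrite ctf2 e2 tE zE polyUE !hornerE /=; ring.
  have cQ : ct (evP f polyQ * psC rho ^+ 2) = x (inord 0) ^+ 2.
    by rewrite ctf2 e3 sE tE zE polyQE !hornerE /=; ring.
  have [phi [X [phiC phiX ctX]]] := lift_point lm (evf _) (evf _) (evf _) (evf2 _) (evf2 _) cU cQ.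
  exists (lC rho), phi, X; split=> // i; rewrite ctX -[RHS]coords_id.
  by rewrite !ctf sE tE zE.
(* The remaining points lie over w = oo: with w = 1 / x, the factor x^2 clears the poles of S, T, Z
   and leaves (-1 : 1 : 0). *)
have lm := infinite_model iota w size1 size2.
have VX : (lX algC)^-1 * lX algC = 1 by rewrite mulVf ?lX_neq0.
have evi m (p' : {poly algC}) : (size p' <= m.+1)%N ->
    evL (lX algC)^-1 p' * (lC rho * lX algC ^+ m) = (evP (psX _) (prev m p') * psC rho)%:F.
  by move=> sp; rewrite mulrCA (pev_prev _ VX) // pev_tofrac mulrC tofracM.
have evi2 m (p' : {poly algC}) : (size p' <= m.*2.+1)%N ->
    evL (lX algC)^-1 p' * (lC rho * lX algC ^+ m) ^+ 2
    = (evP (psX _) (prev m.*2 p') * psC rho ^+ 2)%:F.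
  move=> sp; rewrite exprMn -exprM muln2 mulrCA (pev_prev _ VX) // pev_tofrac mulrC.
  by rewrite tofracM tofracXn.
have ctX' m (p' : {poly algC}) : ct (evP (psX _) (prev m p')) = p'`_m.
  by rewrite ct_pev ct_X horner_coef0 prev0.
have cU : ct (evP (psX _) (prev 2.*2 polyU) * psC rho ^+ 2) = x (inord 3) ^+ 2.
  by rewrite rmorphM rmorphXn /= ctX' ct_C e2 tE zE coef_polyU4; ring.
have cQ : ct (evP (psX _) (prev 2.*2 polyQ) * psC rho ^+ 2) = x (inord 0) ^+ 2.
  by rewrite rmorphM rmorphXn /= ctX' ct_C e3 tE zE coef_polyQ4; ring.
have [phi [X [phiC phiX ctX]]] := lift_point lm (evi 2 _ size_polyS) (evi 2 _ size_polyT)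
  (evi 2 _ size_polyZ) (evi2 2 _ size_polyU) (evi2 2 _ size_polyQ) cU cQ.
exists (lC rho * lX algC ^+ 2), phi, X; split=> // i; rewrite ctX -[RHS]coords_id.
rewrite !rmorphM /= !ctX' ct_C sE tE zE /polyS /polyT /polyZ !coefE /=.
by congr coords; ring.
Qed.

(** For a form vanishing on the curve, the value at the generic point has positive order in every
    finite local model. The denominators g and yi have nonnegative order there, so each numerator
    vanishes at every c, hence is 0. *)
Lemma point_to_generic n (p : {mpoly algC[5]}) : p \is n.-homog ->
  vanishes_on (C242 a) p -> mmap iota xi p = 0.
Proof.
move=> hp vp; set y := mmap iota xi p.
have [g [q0 [q1 [q2 [q3 [g0 yE]]]]]] := decomposition bq size1 size2 y.
have roots c : [/\ root q0 c, root q1 c, root q2 c & root q3 c].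
  have [W [e [e0 WE lm]]] := finite_model bq two sep size1 size2 c.
  have [n1 [n2 [Y1 [Y2 [e1 e2 o1 o2 [Y1E Y2E]]]]]] := model_roots two size1 size2 lm.
  have h (phi : {rmorphism K -> L}) : (forall c, phi (iota c) = lC c) -> phi w = W ->
      order_ge 1 (phi y * 1).
    move=> phiC phiw; set f := poly_ps _ in WE.
    have fc : ct f = c by rewrite /ct /f /poly_ps coefD coefC coefXn -[e]prednK //= addr0.
    have phiev p' : phi (ev p') = (evP f p')%:F.
      by rewrite (rmorph_pev phiC) phiw WE pev_tofrac.
    have [U [UX cU]] : exists U, phi uK = U%:F /\ ct U ^+ 2 = ct (evP f polyU).
      by apply: sqrt_tofrac; rewrite -rmorphXn uKE phiev.
    have [Q [QX cQ]] : exists Q, phi qK = Q%:F /\ ct Q ^+ 2 = ct (evP f polyQ).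
      by apply: sqrt_tofrac; rewrite -rmorphXn qKE phiev.
    pose X := coords Q (evP f polyS) (evP f polyT) U (evP f polyZ).
    have phiX i : phi (xi i) * 1 = (X i)%:F.
      rewrite mulr1; apply: (coords_ind (P := fun b (c : pseries algC) => phi b = c%:F)) => //.
    have [e3 e4] := specialize phiC phiX (fun i => erefl _) hp.
    have : ct (mmap (@psC algC) X p) = 0.
      rewrite e4; apply: vp; apply/C242E; rewrite /= /X.
      have [-> -> -> -> ->] := coordsE Q (evP f polyS) (evP f polyT) U (evP f polyZ).
      rewrite cU cQ !ct_pev fc; split.
        (* The specialized point has a nonzero coordinate: a common root of T and Z would force 1 +
           4 a = 0. *)
        have [T0|T0] := eqVneq polyT.[c] 0; last first.
          exists (inord 2).
          have [_ _ -> _ _] := coordsE Q (evP f polyS) (evP f polyT) U (evP f polyZ).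
          by rewrite ct_pev fc.
        exists (inord 4).
        have [_ _ _ _ ->] := coordsE Q (evP f polyS) (evP f polyT) U (evP f polyZ).
        rewrite ct_pev fc; apply: contra conic_smooth => /eqP Z0.
        have -> : 1 + 4 * a = 4 * polyT.[c] + polyZ.[c] * (1 + 2 * c).
          by rewrite /polyT /polyZ !hornerE; ring.
        by rewrite T0 Z0 mulr0 mul0r addr0.
      exact: curve_at.
    have {}e3 : phi y = (mmap (@psC algC) X p)%:F by move: e3; rewrite expr1n mul1r.
    move=> /ct0_shift Xs; rewrite mulr1 e3 Xs tofracM.
    by exists (psshift (mmap (@psC algC) X p)); rewrite expr1z.
  have [h0 h1' h2' h3] := order_ge_terms bq two lm Y1E Y2E yE h.
  have main (q : {poly algC}) (y' : L) (m : int) : has_order m y' -> (0 <= m) ->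
      order_ge 1 (evL W q / y' / evL W g * 1) -> root q c.
    move=> oy m0; have [->|q0'] := eqVneq q 0; first by rewrite root0.
    have oq := lm_order lm q0'; have og := lm_order lm g0; rewrite mulr1.
    move=> /(order_ge_le (has_orderM (has_orderM oq (has_orderV oy)) (has_orderV og))).
    rewrite -dvdp_XsubCl XsubC_dvd //; case: (mup c q) => [|//]; rewrite muln0 => le1.
    by move: m0 le1; move: (e * _)%N => r; clear; lia.
  have E0 : E != 0 by apply/eqP => E0; move: size1; rewrite E0 mul0r size_poly0.
  have A0 : A != 0 by apply/eqP => A0; move: size1; rewrite A0 mulr0 size_poly0.
  have B0 : B != 0 by apply/eqP => B0; move: size2; rewrite B0 mulr0 size_poly0.
  have o3 := has_orderM (has_orderM o1 o2) (has_orderV (lm_order lm E0)).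
  have e3 := muM lm A0 B0; have e1' := muM lm E0 A0; have e2' := muM lm E0 B0.
  split; last apply: (main _ _ _ o3 _ h3).
  - have o : has_order 0 (1 : L).
      by rewrite -tofrac1; apply: has_order_unit; rewrite rmorph1 oner_eq0.
    by apply: (main _ _ _ o) => //; rewrite divr1.
  - by apply: (main _ _ _ o1) => //; lia.
  - by apply: (main _ _ _ o2) => //; lia.
  lia.
have all_roots (q : {poly algC}) : (forall c, root q c) -> q = 0.
  move=> h; apply/eqP; apply: contraT => /closed_nonrootP[c].
  by rewrite h.
have z q : (forall c, root q c) -> ev q = 0 by move=> /all_roots ->; rewrite rmorph0.
have [z0 z1 z2 z3] : [/\ ev q0 = 0, ev q1 = 0, ev q2 = 0 & ev q3 = 0].
  by split; apply: z => c; have [] := roots c.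
by rewrite yE z0 z1 z2 z3 !mul0r !addr0 mul0r.
Qed.

Definition form_quotient (y : K) : Prop := exists n (F G : {mpoly algC[5]}),
  [/\ F \is n.-homog, G \is n.-homog, mmap iota xi G != 0
    & y = mmap iota xi F / mmap iota xi G].

Lemma form_quotientC c : form_quotient (iota c).
Proof.
exists 0%N, c%:MP, 1; rewrite rmorph1 oner_eq0 mmapC divr1; split=> //.
  by rewrite -[c%:MP]mulr1 mul_mpolyC; apply: dhomogZ; exact: dhomog1.
exact: dhomog1.
Qed.

Lemma form_quotientD x y : form_quotient x -> form_quotient y -> form_quotient (x + y).
Proof.
move=> [n [F [G [hF hG G0 ->]]]] [m [F' [G' [hF' hG' G0' ->]]]].
exists (n + m)%N, (F * G' + F' * G), (G * G'); split.
- by apply: rpredD; [exact: dhomogM | rewrite addnC; exact: dhomogM].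
- exact: dhomogM.
- by rewrite rmorphM mulf_neq0.
by rewrite addf_div // rmorphD !rmorphM.
Qed.

Lemma form_quotientM x y : form_quotient x -> form_quotient y -> form_quotient (x * y).
Proof.
move=> [n [F [G [hF hG G0 ->]]]] [m [F' [G' [hF' hG' G0' ->]]]].
exists (n + m)%N, (F * F'), (G * G'); split.
- exact: dhomogM.
- exact: dhomogM.
- by rewrite rmorphM mulf_neq0.
by rewrite mulf_div !rmorphM.
Qed.

Lemma form_quotientV x : x != 0 -> form_quotient x -> form_quotient x^-1.
Proof.
move=> x0 [n [F [G [hF hG G0 xE]]]]; exists n, G, F; split=> //.
  by apply: contraNneq x0 => F0; rewrite xE F0 mul0r.
by rewrite xE invf_div.
Qed.

Lemma form_quotient_coord i j : xi j != 0 -> form_quotient (xi i / xi j).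
Proof.
move=> j0; have hX l : ('X_l : {mpoly algC[5]}) \is 1.-homog.
  by rewrite dhomogX; apply/eqP; exact: mdeg1.
by exists 1%N, 'X_i, 'X_j; rewrite !mmapX !mmap1U.
Qed.

(** Generators suffice: w = (s - t) / z, and u / z = h1(w) y1 / Z(w) yields y1, as q / z yields
    y2. *)
Lemma all_form_quotient y : form_quotient y.
Proof.
have inj := bq_inj bq; have FD := form_quotientD; have FM := form_quotientM.
have EA0 : E * A != 0 by rewrite -size_poly_gt0 size1.
have EB0 : E * B != 0 by rewrite -size_poly_gt0 size2.
have [xi0 xi1 xi2 xi3 xi4] := coordsE qK (ev polyS) (ev polyT) uK (ev polyZ).
rewrite -/xi in xi0 xi1 xi2 xi3 xi4.
have Z0 : ev polyZ != 0.
  rewrite -(rmorph0 ev) (inj_eq inj); apply/eqP => /(congr1 (fun p : {poly algC} => p.[0])).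
  have -> : polyZ.[0] = 1 by rewrite /polyZ !hornerE; ring.
  by rewrite horner0 => /eqP; rewrite oner_eq0.
have xi40 : xi (inord 4) != 0 by rewrite xi4.
have Fw : form_quotient w.
  have -> : w = (xi (inord 1) + iota (-1) * xi (inord 2)) / xi (inord 4).
    rewrite xi1 xi2 xi4 rmorphN1 mulN1r -rmorphB /=.
    have -> : polyS - polyT = 'X * polyZ by rewrite /polyS /polyT /polyZ -mul_polyC; ring.
    by rewrite rmorphM /= pevX mulfK.
  rewrite mulrDl -mulrA; apply: (FD); first exact: form_quotient_coord.
  by apply: (FM); [exact: form_quotientC | exact: form_quotient_coord].
have Fev p : form_quotient (ev p) by apply: pev_closed => //; exact: form_quotientC.
have Froot (h : {poly algC}) y' i : h != 0 -> xi i = ev h * y' -> form_quotient y'.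
  move=> h0 e; have eh : ev h != 0 by rewrite -(inj_eq inj) rmorph0 in h0.
  have -> : y' = xi i / xi (inord 4) * ev polyZ * (ev h)^-1.
    by rewrite e xi4; field; apply/andP.
  apply: (FM); last exact: form_quotientV.
  by apply: (FM) => //; exact: form_quotient_coord.
have h10 : h1 != 0.
  apply: contraTneq (oner_neq0 algC) => h10.
  by rewrite -coef_polyU4 UE h10 expr0n mul0r coef0 eqxx.
have h20 : h2 != 0.
  apply: contraTneq (oner_neq0 algC) => h20.
  by rewrite -coef_polyQ4 QE h20 expr0n mul0r coef0 eqxx.
apply: (bq_ind bq) => //.
- exact: form_quotientC.
- exact: Froot h10 xi3.
- exact: Froot h20 xi0.
- exact: form_quotientV.
Qed.

Lemma is_function_field_C242 : is_function_field (C242 a) iota xi.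
Proof.
split=> [n p hp|y]; last exact: all_form_quotient.
by split; [exact: (generic_to_point hp) | exact: (point_to_generic hp)].
Qed.

Lemma genus_C242 : has_geometric_genus (C242 a) (m1.-1 + m2.-1 + m3.-1).
Proof.
have EA0 : E * A != 0 by rewrite -size_poly_gt0 size1.
have EB0 : E * B != 0 by rewrite -size_poly_gt0 size2.
exists K, iota, xi, K^o, d; split.
- exact: is_function_field_C242.
- exact: has_trdeg1 bq.
- exact: (is_kaehler_d bq).
- exact: (has_dim_regular bq).
Qed.

End Curve.

(** * The three cases *)

Section SimpleRoots.

Variable k : fieldType.
Implicit Types p q : {poly k}.

Definition simple_roots p := forall c, root p c -> ~~ root p^`() c.

Lemma simple_rootsM p q : simple_roots p -> simple_roots q ->
  (forall c, root p c -> ~~ root q c) -> simple_roots (p * q).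
Proof.
move=> sp sq pq c; rewrite rootM derivM /root !hornerE => /orP[] r0; have := r0.
  have := sp c r0; have := pq c r0; rewrite /root => q0 p'0 /eqP ->.
  by rewrite mul0r addr0 mulf_neq0.
have := sq c r0; rewrite /root => q'0 /eqP q0.
rewrite q0 mulr0 add0r mulf_neq0 //; apply/negP => /pq.
by rewrite /root q0 eqxx.
Qed.

(** The cofactors are plain functions, so that an explicit identity is checked by [ring] at a
    variable point. *)
Lemma coprime_roots_bezout p q (U V : k -> k) n : n != 0 ->
  (forall r, U r * p.[r] + V r * q.[r] = n) -> forall c, root p c -> ~~ root q c.
Proof.
move=> n0 UV c /eqP pc; apply/negP => /eqP qc; move/eqP: n0; apply.
by rewrite -(UV c) pc qc !mulr0 addr0.
Qed.

Lemma simple_roots_bezout p (U V : k -> k) n : n != 0 ->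
  (forall r, U r * p.[r] + V r * p^`().[r] = n) -> simple_roots p.
Proof. exact: coprime_roots_bezout. Qed.

Lemma size_poly_eq p n : (forall j, (n < j)%N -> p`_j = 0) -> p`_n != 0 -> size p = n.+1.
Proof.
move=> h pn; apply/eqP; rewrite eqn_leq; apply/andP; split; first exact/leq_sizeP.
by rewrite ltnNge; apply: contra pn => /leq_sizeP ->.
Qed.

End SimpleRoots.

Lemma sqr_divf (F : fieldType) (x e p : F) :
  e != 0 -> x ^+ 2 = p * e ^+ 2 -> (x / e) ^+ 2 = p.
Proof. by move=> e0 xE; rewrite expr_div_n xE mulfK // expf_neq0. Qed.

(** The successors in the sizes give E A, E B and A B positive degree, hence a simple root, hence
    non-squareness in k(w); and (E A)(E B) is A B times the square of E. *)
Lemma genus_of_factorization (a : algC) (A B E h1 h2 : {poly algC}) (m1 m2 m3 : nat) :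
  simple_roots (A * B * E) ->
  size (E * A) = m1.+1.*2.+1 -> size (E * B) = m2.+1.*2.+1 -> size (A * B) = m3.+1.*2.+1 ->
  polyU a = h1 ^+ 2 * (E * A) -> polyQ a = h2 ^+ 2 * (E * B) -> 1 + 4 * a != 0 ->
  has_geometric_genus (C242 a) (m1 + m2 + m3).
Proof.
move=> sep s1 s2 s3 UE QE smooth.
have two : (2 : algC) != 0 by rewrite pnatr_eq0.
have E0 : E != 0 by apply/eqP => E0; move: s1; rewrite E0 mul0r size_poly0.
have nsq (p q : {poly algC}) n : size p = n.+1.*2.+1 -> p * q = A * B * E ->
    forall x : {fraction {poly algC}}, x ^+ 2 != FracField.tofrac p.
  move=> sp pq; have /closed_rootP[c pc] : size p != 1%N by rewrite sp doubleS.
  exact: nonsquare_simple_root pc (simple_factor sep pq pc).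
have nsq1 := nsq _ B _ s1 ltac:(ring); have nsq2 := nsq _ A _ s2 ltac:(ring).
have nsq3 := nsq _ E _ s3 (erefl _).
have nsq12 (x : {fraction {poly algC}}) : x ^+ 2 != FracField.tofrac (E * A * (E * B)).
  apply: contra (nsq3 (x / FracField.tofrac E)) => /eqP e; apply/eqP.
  apply: sqr_divf; first by rewrite tofrac_eq0.
  by rewrite e -tofracXn -tofracM; congr FracField.tofrac; ring.
have [K [iota [w [y1 [y2 [d bq]]]]]] := biquadratic_exists two nsq1 nsq2 nsq12.
exact: genus_C242 bq sep s1 s2 s3 UE QE smooth.
Qed.

Ltac horner_ring :=
  rewrite ?(derivD, derivN, derivZ, derivXn, derivX, derivC)
    ?(hornerD, hornerN, hornerZ, hornerMn, hornerXn, hornerX, hornerC) /=; ring.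

(** Here U = w^2 A. Although Q also vanishes at w = 0, the double root of U drops out, and A and Q
    have no common root. *)
Lemma genus_C242_0 : has_geometric_genus (C242 0) 3.
Proof.
pose A : {poly algC} := 'X^2 + 2 *: 'X - 1%:P.
pose B : {poly algC} := 'X^4 + 2 *: 'X^3 - 3 *: 'X^2 + 'X.
have sA : size A = 3.
  apply: size_poly_eq => [[|[|[|j]]] // _|]; first by rewrite /A !coefE /=; ring.
  by rewrite /A !coefE /= (_ : _ + _ - _ = 1) ?oner_neq0 //; ring.
have sB : size B = 5.
  apply: size_poly_eq => [[|[|[|[|[|j]]]]] // _|]; first by rewrite /B !coefE /=; ring.
  by rewrite /B !coefE /= (_ : _ + _ = 1) ?oner_neq0 //; ring.
have A0 : A != 0 by rewrite -size_poly_gt0 sA.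
have B0 : B != 0 by rewrite -size_poly_gt0 sB.
apply: (@genus_of_factorization 0 A B 1 'X 1 0 1 2).
- rewrite mulr1; apply: simple_rootsM.
  + apply: (@simple_roots_bezout _ _ (fun=> -2) (fun r => 1 + r) 4); first by rewrite pnatr_eq0.
    by move=> r; rewrite /A; horner_ring.
  (* A Bezout identity cleared of denominators; -23 is the discriminant of [B]. *)
  + apply: (@simple_roots_bezout _ _ (fun r => 140 + 384 * r + 144 * r ^+ 2)
      (fun r => 23 - 2 * r - 114 * r ^+ 2 - 36 * r ^+ 3) 23); first by rewrite pnatr_eq0.
    by move=> r; rewrite /B; horner_ring.
  + apply: (@coprime_roots_bezout _ _ _ (fun r => -1 + 10 * r - 12 * r ^+ 2 - 5 * r ^+ 3)
      (fun r => 12 + 5 * r) 1); first exact: oner_neq0.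
    by move=> r; rewrite /A /B; horner_ring.
- by rewrite mul1r.
- by rewrite mul1r.
- by rewrite size_mul // sA sB.
- by rewrite /polyU /A -!mul_polyC; ring.
- by rewrite /polyQ /B -!mul_polyC; ring.
by rewrite mulr0 addr0 oner_neq0.
Qed.

(** The common root w = -4 of U and Q is the point s = -2, t = 2, u = q = 0 at z = 1. *)
Lemma genus_C242_2 : has_geometric_genus (C242 2) 4.
Proof.
pose A : {poly algC} := 'X^3 - 2 *: 'X^2 + 3 *: 'X.
pose B : {poly algC} := 'X^3 - 2 *: 'X^2 + 'X + 1%:P.
pose E : {poly algC} := 'X + 4%:P.
have sA : size A = 4.
  apply: size_poly_eq => [[|[|[|[|j]]]] // _|]; first by rewrite /A !coefE /=; ring.
  by rewrite /A !coefE /= (_ : _ + _ = 1) ?oner_neq0 //; ring.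
have sB : size B = 4.
  apply: size_poly_eq => [[|[|[|[|j]]]] // _|]; first by rewrite /B !coefE /=; ring.
  by rewrite /B !coefE /= (_ : _ + _ = 1) ?oner_neq0 //; ring.
have sE : size E = 2 by rewrite /E size_XaddC.
have A0 : A != 0 by rewrite -size_poly_gt0 sA.
have B0 : B != 0 by rewrite -size_poly_gt0 sB.
have E0 : E != 0 by rewrite -size_poly_gt0 sE.
have AE : forall c, root A c -> ~~ root E c.
  (* As [E] is linear with root -4, the constant is -A(-4); for [BE] it is -B(-4). *)
  apply: (@coprime_roots_bezout _ _ _ (fun=> -1) (fun r => 27 - 6 * r + r ^+ 2) 108).
    by rewrite pnatr_eq0.
  by move=> r; rewrite /A /E; horner_ring.
have BE : forall c, root B c -> ~~ root E c.
  apply: (@coprime_roots_bezout _ _ _ (fun=> -1) (fun r => 25 - 6 * r + r ^+ 2) 99).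
    by rewrite pnatr_eq0.
  by move=> r; rewrite /B /E; horner_ring.
apply: (@genus_of_factorization 2 A B E 1 1 1 1 2).
- apply: simple_rootsM; first apply: simple_rootsM.
  + apply: (@simple_roots_bezout _ _ (fun r => 29 - 15 * r) (fun r => 12 - 13 * r + 5 * r ^+ 2) 36).
      by rewrite pnatr_eq0.
    by move=> r; rewrite /A; horner_ring.
  + apply: (@simple_roots_bezout _ _ (fun r => 25 + 6 * r) (fun r => 6 - 7 * r - 2 * r ^+ 2) 31).
      by rewrite pnatr_eq0.
    by move=> r; rewrite /B; horner_ring.
  + apply: (@coprime_roots_bezout _ _ _ (fun r => -1 + 6 * r - 4 * r ^+ 2)
      (fun r => 9 - 6 * r + 4 * r ^+ 2) 9); first by rewrite pnatr_eq0.
    by move=> r; rewrite /A /B; horner_ring.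
  + apply: (@simple_roots_bezout _ _ (fun=> 0) (fun=> 1) 1); first exact: oner_neq0.
    by move=> r; rewrite /E; horner_ring.
  + by move=> c; rewrite rootM => /orP[/AE|/BE].
- by rewrite size_mul // sA sE.
- by rewrite size_mul // sB sE.
- by rewrite size_mul // sA sB.
- by rewrite /polyU /A /E -!mul_polyC; ring.
- by rewrite /polyQ /B /E -!mul_polyC; ring.
by rewrite (_ : 1 + 4 * 2 = 9) ?pnatr_eq0 //; ring.
Qed.

(** At a common zero U = Q forces S = -T, the conic gives T = a Z, and U = 0 becomes a (a - 2) Z^2 =
    0. *)
Lemma coprime_polyUQ (a : algC) : a != 0 -> a != 2 -> 1 + 4 * a != 0 ->
  forall c, root (polyU a) c -> ~~ root (polyQ a) c.
Proof.
move=> a0 a2 a4 c /eqP U0; apply/negP => /eqP Q0; have [e1 e2 e3] := curve_at a c.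
move: e1 e2 e3; rewrite U0 Q0.
have : 4 * (polyT a).[c] + polyZ.[c] * (1 + 2 * c) = 1 + 4 * a.
  by rewrite /polyT /polyZ !hornerE; ring.
move: (polyS a).[c] (polyT a).[c] polyZ.[c] => S T Z TZ e1 e2 e3.
have nz : (T != 0) || (Z != 0).
  apply: contraNT a4; rewrite negb_or !negbK => /andP[/eqP T0 /eqP Z0].
  by rewrite -TZ T0 Z0 mulr0 mul0r addr0.
have Z0 : Z != 0.
  apply: contraTneq nz => Z0; rewrite Z0 eqxx orbF negbK.
  by have := e2; rewrite Z0 mulr0 expr0n mulr0 !subr0 => /esym/eqP; rewrite expf_eq0.
have ST : S = - T.
  apply: (mulIf Z0); apply/eqP; rewrite mulNr -addr_eq0; apply/eqP.
  transitivity ((T ^+ 2 + S * Z - a * Z ^+ 2) - (T ^+ 2 - T * Z - a * Z ^+ 2)); first by ring.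
  by rewrite -e2 -e3 subrr.
have TaZ : T = a * Z.
  apply: (mulIf Z0); apply/eqP; rewrite -subr_eq0; apply/eqP.
  transitivity ((T ^+ 2 + T * Z - a * Z ^+ 2) - T ^+ 2); first by ring.
  by rewrite -e1 ST; ring.
have : Z ^+ 2 * (a * (a - 2)) = 0 by rewrite [RHS]e2 TaZ; ring.
by move/eqP; rewrite !mulf_eq0 (negPf Z0) (negPf a0) subr_eq0 (negPf a2).
Qed.

(** The Bezout constant 4 a (1 + 4 a)^3 vanishes exactly where U degenerates: 0 is a double root for
    a = 0, and U is a square for 1 + 4 a = 0. *)
Lemma simple_roots_polyU (a : algC) : a != 0 -> 1 + 4 * a != 0 -> simple_roots (polyU a).
Proof.
move=> a0 a4; apply: (@simple_roots_bezout _ _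
  (fun r => (-2 - 52 * a + 208 * a ^+ 2) + (6 - 224 * a + 32 * a ^+ 2) * r
     + (4 - 112 * a) * r ^+ 2)
  (fun r => (-9 * a + 110 * a ^+ 2 + 8 * a ^+ 3) + (1 + 7 * a - 84 * a ^+ 2) * r
     + (-2 + 70 * a - 8 * a ^+ 2) * r ^+ 2 + (-1 + 28 * a) * r ^+ 3)
  (4 * a * (1 + 4 * a) ^+ 3)).
  by rewrite !mulf_neq0 ?expf_neq0 // pnatr_eq0.
by move=> r; rewrite /polyU; horner_ring.
Qed.

Lemma genus_C242_critical (c a : algC) :
  4 * c ^+ 3 + 6 * c ^+ 2 + 2 * c + 1 = 0 -> a = (c ^+ 2 + c) ^+ 2 + c ->
  has_geometric_genus (C242 a) 3.
Proof.
move=> cub aE.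
(* Each nonvanishing below comes from a Bezout identity between the cubic in c and the quantity [x],
   with a positive integer on the other side. *)
have bezout (x U V : algC) n :
    n.+1%:R = U * (4 * c ^+ 3 + 6 * c ^+ 2 + 2 * c + 1) + V * x -> x != 0.
  move=> e; apply/eqP => x0; move: e; rewrite cub x0 !mulr0 addr0 => /eqP.
  by rewrite pnatr_eq0.
have a0 : a != 0.
  apply: (bezout _ (23 + 38 * c + 62 * c ^+ 2 + 28 * c ^+ 3) (-84 - 192 * c - 112 * c ^+ 2) 22).
  by rewrite aE; ring.
have a2 : a != 2.
  rewrite -subr_eq0; apply: (bezout _ (191 + 502 * c + 110 * c ^+ 2 - 4 * c ^+ 3)
    (-1780 - 448 * c + 16 * c ^+ 2) 3750).
  by rewrite aE; ring.
have a4 : 1 + 4 * a != 0.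
  apply: (bezout _ (5 + 4 * c + 14 * c ^+ 2 + 8 * c ^+ 3) (-1 - 10 * c - 8 * c ^+ 2) 3).
  by rewrite aE; ring.
(* [B] is the quotient of Q by (w + c^2)^2, the double root being the point q = 0, s = c, t = c^2 +
   c; the remainder of this division is a multiple of the cubic, as the proof of [QE] displays. *)
pose b := 2 - 2 * c ^+ 2; pose e := - 3 - 2 * c - 6 * c ^+ 2 - 4 * c ^+ 3 + c ^+ 4.
pose B : {poly algC} := 'X^2 + b *: 'X + e%:P.
pose h : {poly algC} := 'X + (c ^+ 2)%:P.
have disc : b ^+ 2 - 4 * e != 0.
  apply: (bezout _ (24 - 8 * c + 32 * c ^+ 2) (-1 - 2 * c - 8 * c ^+ 2) 7).
  by rewrite /b /e; ring.
have sU : size (polyU a) = 5.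
  apply: size_poly_eq => [j /(leq_trans (size_polyU a))|]; last by rewrite coef_polyU4 oner_neq0.
  exact: nth_default.
have sB : size B = 3.
  apply: size_poly_eq => [[|[|[|j]]] // _|]; first by rewrite /B !coefE /=; ring.
  by rewrite /B !coefE /= (_ : _ + _ = 1) ?oner_neq0 //; ring.
have U0 : polyU a != 0 by rewrite -size_poly_gt0 sU.
have B0 : B != 0 by rewrite -size_poly_gt0 sB.
have QE : polyQ a = h ^+ 2 * B.
  apply/eqP; rewrite -subr_eq0; apply/eqP.
  transitivity ((4 * c ^+ 3 + 6 * c ^+ 2 + 2 * c + 1) *: ((1 + 2 * c ^+ 2) *: 'X
     + (c ^+ 2 + 2 * c ^+ 4)%:P : {poly algC})); last by rewrite cub scale0r.
  by rewrite /polyQ /h /B /b /e aE -!mul_polyC; ring.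
apply: (@genus_of_factorization a (polyU a) B 1 1 h 1 0 2).
- rewrite mulr1; apply: simple_rootsM; first exact: simple_roots_polyU.
    apply: (@simple_roots_bezout _ _ (fun=> -4) (fun r => 2 * r + b) (b ^+ 2 - 4 * e)) => // r.
    by rewrite /B; horner_ring.
  move=> r /(coprime_polyUQ a0 a2 a4); apply: contra.
  by rewrite QE rootM => ->; rewrite orbT.
- by rewrite mul1r sU.
- by rewrite mul1r sB.
- by rewrite size_mul // sU sB.
- by rewrite expr1n !mul1r.
- by rewrite mul1r.
exact: a4.
Qed.

Theorem theorem4p6 (a : algC) :
  (a = 0 -> has_geometric_genus (C242 a) 3) /\
  (a = 2 -> has_geometric_genus (C242 a) 4) /\
  (critical_value 3 a -> has_geometric_genus (C242 a) 3).
Proof.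
split=> [->|]; first exact: genus_C242_0.
split=> [->|/critical_value3E[c [cub aE]]]; first exact: genus_C242_2.
exact: genus_C242_critical cub aE.
Qed.
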